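(* Let $F$, the partitions $\{A_j^m\}_{j=0}^m$, the sequences $h_m,\delta_m,\sigma_m>0$, the constant $\sigma_0>0$ and the model $p(y|x,\mathcal{M}_0)$ be as described in the context. Suppose: (a) $h_m\to0$, and for every $y\in Y$ there exists $M_0$ such that $C_{\delta_m}(y)\cap A_0^m=\varnothing$ for all $m\ge M_0$; (b) $\delta_m\to 0$, $\sigma_m/\delta_m\to 0$, $\delta_m^{d-1}h_m/\sigma_m^d\to 0$; (c) $f(y|x)$ is continuous in $y$ a.s. $F$; (d) the second moments of $y$ under $F$ are finite; (e) there is $r>0$ such that for any $(y,x)$ there exists a hypercube $C(r,y,x)$ with side length $r$ and $y\in C(r,y,x)$ such that (i) $$\int \log\frac{f(y|x)}{\inf_{z\in C(r,y,x)}f(z|x)}\,F(dy,dx)<\infty$$ and (ii) there exists $M_3$ such that for any $m\ge M_3$: if $y\in A_0^m$, then $C(r,y,x)\cap A_0^m$ contains a hypercube $C_0(r,y,x)$ with side length $r/2$ and a vertex at $y$; and if $y\in Y\setminus A_0^m$, then $C(r,y,x)\cap(Y\setminus A_0^m)$ contains a hypercube $C_1(r,y,x)$ with side length $r/2$ and a vertex at $y$; (f) $1>2^{-(d+1)}>\phi(y,0,\sigma_0)\,\lambda(C_0(r,y,x))$; (g) $X$ is compact and, for $j=0,1,\dots,m$, $F(A_j^m|x)$ is a continuous function of $x$ on $X$ with $F(A_j^m|x)>0$. Let $\varepsilon_m>0$, $\varepsilon_m\to0$, and let $P_j^m(x)$ be finite order polynomials in $x$ such that $$|\log F(A_j^m|x)-P_j^m(x)|<\varepsilon_m\quad\text{for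 all }x\in X,\ j=0,1,\dots,m$$ (such polynomials exist by the Stone--Weierstrass theorem). Define $$p(y|x,\mathcal{M}_1)=\sum_{j=1}^m\alpha_j^m(x)\phi(y,\mu_j^m,\sigma_m)+\alpha_0^m(x)\phi(y,0,\sigma_0),\qquad \alpha_j^m(x)=\frac{\exp\{P_j^m(x)\}}{\sum_{k=0}^m\exp\{P_k^m(x)\}}.$$ Then $$d_{\mathrm{KL}}(F,\mathcal{M}_0)-2\varepsilon_m\le d_{\mathrm{KL}}(F,\mathcal{M}_1)\le d_{\mathrm{KL}}(F,\mathcal{M}_0)+2\varepsilon_m,$$ and thus $d_{\mathrm{KL}}(F,\mathcal{M}_1)\to0$ as $m\to\infty$.
   Context: $F$ is a probability distribution on $Y\times X$, $Y\subset\mathbb{R}^d$, $X\subset\mathbb{R}^{d_x}$. The conditional distribution of $y$ given $x$ has a density $f(y|x)$ with respect to Lebesgue measure $\lambda$; the marginal of $x$ has a density $f(x)$ with respect to some generic measure. $F(A|x)=\int_A f(y|x)\,dy$. $\phi(y,\mu,\sigma)$ is the density at $y\in\mathbb{R}^d$ of the normal distribution with mean $\mu$ and covariance matrix $\sigma^2 I$. For a model $\mathcal{M}$ with conditional density $p(y|x,\mathcal{M})$, $$d_{\mathrm{KL}}(F,\mathcal{M})=\int\log\frac{f(y|x)}{p(y|x,\mathcal{M})}\,F(dy,dx).$$ Hypercubes have edges parallel to the coordinate axes. $C_\delta(y)$ is the hypercube with center $y$ and side length $\delta$. For each $m$, $A_0^m,A_1^m,\dots,A_m^m$ is a partition of $Y$,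 where $A_1^m,\dots,A_m^m$ are adjacent half-open half-closed hypercubes with side length $h_m$ (cells of a regular cubic grid) and $A_0^m$ is the rest of $Y$. $\mu_j^m$ is the center of $A_j^m$, $j\ge1$; $\sigma_0$ is fixed (independent of $m$). The model $\mathcal{M}_0$ is $$p(y|x,\mathcal{M}_0)=\sum_{j=1}^m F(A_j^m|x)\,\phi(y,\mu_j^m,\sigma_m)+F(A_0^m|x)\,\phi(y,0,\sigma_0).$$ *)

(* Defs.v *)
From HB Require Import structures.
From mathcomp Require Import all_boot all_order all_algebra.
From mathcomp Require Import all_classical all_reals all_analysis.
From mathcomp Require mpoly.

Set Implicit Arguments.
Unset Strict Implicit.
Unset Printing Implicit Defensive.

Import Order.TTheory GRing.Theory Num.Theory.
Import numFieldNormedType.Exports.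

Local Open Scope classical_set_scope.
Local Open Scope ring_scope.

(* 'rV[R]_n carries the sigma-algebra generated by its coordinates, as the    *)
(* library does for n.-tuple R; it is the Borel sigma-algebra of R^n.         *)
Definition rV_display : measure_display -> measure_display.
Proof. exact. Qed.

Section measurable_rV.
Variables (R : realType) (n : nat).

Let coord (i : 'I_n) (v : 'rV[R]_n) : R := v 0 i.

Let rV_set0 : g_sigma_preimage coord set0.
Proof. exact: sigma_algebra0. Qed.

Let rV_setC A : g_sigma_preimage coord A -> g_sigma_preimage coord (~` A).
Proof. exact: sigma_algebraC. Qed.

Let rV_bigcup (F : (set 'rV[R]_n)^nat) :
  (forall i, g_sigma_preimage coord (F i)) ->
  g_sigma_preimage coord (\bigcup_i F i).
Proof. exact: sigma_algebra_bigcup. Qed.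

HB.instance Definition _ :=
  @isMeasurable.Build (rV_display default_measure_display)
    'rV[R]_n (g_sigma_preimage coord) rV_set0 rV_setC rV_bigcup.

Lemma measurable_rV_coord (i : 'I_n) :
  measurable_fun [set: 'rV[R]_n] (fun v : 'rV[R]_n => v 0 i).
Proof.
move=> _ B mB; rewrite setTI; apply: sub_sigma_algebra => /=.
rewrite -bigcup_seq/=; exists i => /=; first by rewrite mem_index_enum.
by exists B => //; rewrite setTI.
Qed.

Lemma measurable_fun_rV d (T : measurableType d) (f : T -> 'rV[R]_n) :
  (forall i, measurable_fun [set: T] (fun t => f t 0 i)) ->
  measurable_fun [set: T] f.
Proof.
move=> mf.
suff H : g_sigma_preimage (fun i => coord i \o f) `<=` measurable.
  move=> _ A mA; apply: H; rewrite g_sigma_preimage_comp.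
  by exists A.
apply: smallest_sub; first exact: sigma_algebra_measurable.
rewrite -bigcup_seq/=; apply: bigcup_sub => i _ A [B mB <-].
exact: mf.
Qed.

End measurable_rV.

Section lebesgue_rV.
Variable R : realType.
Local Open Scope ereal_scope.

Section step.
Variable n : nat.
Local Notation U := (measurableTypeR R * 'rV[R]_n)%type.

Definition rV_cons (z : U) : 'rV[R]_n.+1 :=
  row_mx (const_mx z.1 : 'rV[R]_1) z.2.

Definition rV_uncons (v : 'rV[R]_n.+1) : U :=
  (v 0%R 0%R, \row_(i < n) v 0%R (lift ord0 i)).

Lemma rV_consE (z : U) (i : 'I_n.+1) :
  rV_cons z 0%R i = if unlift ord0 i is Some j then z.2 0%R j else z.1.
Proof.
rewrite /rV_cons; case: unliftP => [j ->|->].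
  by rewrite -rshift1 (@row_mxEr _ 1 1 n).
have -> : ord0 = lshift n (ord0 : 'I_1) by exact: ord_inj.
by rewrite (@row_mxEl _ 1 1 n) mxE.
Qed.

Lemma rV_consK : cancel rV_cons rV_uncons.
Proof.
move=> z; rewrite /rV_uncons; case: z => a v; congr pair.
  by rewrite rV_consE unlift_none.
by apply/rowP => i; rewrite mxE rV_consE liftK.
Qed.

Lemma rV_unconsK : cancel rV_uncons rV_cons.
Proof.
move=> v; apply/rowP => i; rewrite rV_consE.
by case: unliftP => [j ->|->] //=; rewrite mxE.
Qed.

Lemma measurable_rV_cons : measurable_fun [set: U] rV_cons.
Proof.
apply: measurable_fun_rV => i.
under eq_fun do rewrite rV_consE.
case: unliftP => [j _|_]; last exact: measurable_fst.
apply: (measurableT_comp (measurable_rV_coord j)).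
exact: measurable_snd.
Qed.

Lemma measurable_rV_uncons : measurable_fun [set: 'rV[R]_n.+1] rV_uncons.
Proof.
apply: measurable_fun_pair; first exact: measurable_rV_coord.
apply: measurable_fun_rV => i.
under eq_fun do rewrite mxE.
exact: measurable_rV_coord.
Qed.

Variable mu : {sigma_finite_measure set 'rV[R]_n -> \bar R}.

Definition lebesgue_rV_step : set 'rV[R]_n.+1 -> \bar R :=
  pushforward (@lebesgue_measure R \x mu) rV_cons.

HB.instance Definition _ := Measure.copy lebesgue_rV_step
  (measure_function_pushforward__canonical__measure_function_Measure
     (@lebesgue_measure R \x mu) measurable_rV_cons).

Let lebesgue_rV_step_sigma_finite : sigma_finite setT lebesgue_rV_step.
Proof.
have /sigma_finiteP[F [TF ndF Foo]] := sigma_finiteT (@lebesgue_measure R).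
have /sigma_finiteP[G [TG ndG Goo]] := sigma_finiteT mu.
exists (fun k => rV_uncons @^-1` (F k `*` G k)).
  rewrite -preimage_bigcup (_ : \bigcup_k _ = setT) ?preimage_setT//.
  apply/seteqP; split=> // -[x y] _.
  have [j _ Fjx] : (\bigcup_k F k) x by rewrite -TF.
  have [k _ Gky] : (\bigcup_k G k) y by rewrite -TG.
  exists (maxn j k) => //; split => /=.
    by move: x Fjx; exact/subsetPset/ndF/leq_maxl.
  by move: y Gky; exact/subsetPset/ndG/leq_maxr.
move=> k; have [mF Fk] := Foo k; have [mG Gk] := Goo k; split.
  rewrite -[X in measurable X]setTI; apply: measurable_rV_uncons => //.
  exact: measurableX.
rewrite /lebesgue_rV_step /pushforward -comp_preimage.
rewrite (_ : rV_uncons \o rV_cons = id) ?preimage_id//.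
  by rewrite product_measure1E// lte_mul_pinfty// ge0_fin_numE.
by apply/funext => z; exact: rV_consK.
Qed.

HB.instance Definition _ := Measure_isSigmaFinite.Build _ _ _
  lebesgue_rV_step lebesgue_rV_step_sigma_finite.

End step.

(* n-dimensional Lebesgue measure: the n-fold product of [lebesgue_measure]   *)
Fixpoint lebesgue_rV n : {sigma_finite_measure set 'rV[R]_n -> \bar R} :=
  if n is n'.+1 then lebesgue_rV_step (lebesgue_rV n')
  else \d_(0%R : 'rV[R]_0).

Lemma lebesgue_rV_box n (B : 'I_n -> set R) : (forall i, measurable (B i)) ->
  lebesgue_rV n [set v | forall i, B i (v 0%R i)] =
  \prod_(i < n) lebesgue_measure (B i).
Proof.
elim: n B => [|n IH] B mB.
  by rewrite big_ord0/= diracE mem_set// => -[].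
rewrite big_ord_recl/= /lebesgue_rV_step /pushforward.
rewrite -(IH (fun i => B (lift ord0 i)))//.
pose C := [set v : 'rV[R]_n | forall i, B (lift ord0 i) (v 0%R i)].
have mC : measurable C.
  rewrite (_ : C = \big[setI/setT]_(i < n)
      ((fun v : 'rV[R]_n => v 0%R i) @^-1` B (lift ord0 i))).
    apply: bigsetI_measurable => i _.
    by rewrite -[X in measurable X]setTI; exact: measurable_rV_coord.
  rewrite -bigcap_seq; apply/seteqP; split => [v Bv i _|v Bv i]; first exact: Bv.
  by apply: (Bv i); rewrite /= mem_index_enum.
have := @product_measure1E _ _ (measurableTypeR R) _ R (@lebesgue_measure R)
  (lebesgue_rV n) (B ord0) C (mB ord0) mC.
move=> <-; congr (_ _); apply/seteqP; split => [z /= Bz|z /= [Bz1 Bz2] i].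
  split; first by have := Bz ord0; rewrite rV_consE unlift_none.
  by move=> i; have := Bz (lift ord0 i); rewrite rV_consE liftK.
by rewrite rV_consE; case: unliftP => [j ->|->].
Qed.

End lebesgue_rV.
Arguments lebesgue_rV {R n}.

Section cubes.
Variables (R : realType) (d : nat).
Implicit Types (c y : 'rV[R]_d) (s h : R).

(* The product of the intervals with endpoints c_i - s/2 and c_i + s/2; the   *)
(* left endpoint i is included iff [l i], the right one iff [~~ r i].         *)
Definition cube (l r : 'I_d -> bool) c s : set 'rV[R]_d :=
  [set y | forall i, y 0 i \in
    Interval (BSide (l i) (c 0 i - s / 2)) (BSide (r i) (c 0 i + s / 2))].

Definition closed_cube c s := cube (fun=> true) (fun=> false) c s.

Definition is_hypercube s (C : set 'rV[R]_d) :=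
  exists l r c, C = cube l r c s.

Definition is_hypercube_with_vertex y s (C : set 'rV[R]_d) :=
  exists l r c, C = cube l r c s /\ forall i, `|y 0 i - c 0 i| = s / 2.

(* [A ord0] is the remainder A_0; the cells A_1, ..., A_m are the             *)
(* [A (lift ord0 j)], j : 'I_m, with centers [mu j] on the lattice o + h Z^d. *)
(* The bool selects the half-open convention [a, b[ or ]a, b].                *)
Definition cubic_partition (Y : set 'rV[R]_d) h m
    (A : 'I_m.+1 -> set 'rV[R]_d) (mu : 'I_m -> 'rV[R]_d) :=
  partition [set: 'I_m.+1] A Y /\
  exists (b : bool) (o : 'rV[R]_d) (k : 'I_m -> 'I_d -> int), forall j,
    (forall i, mu j 0 i = o 0 i + h * (k j i)%:~R) /\
    A (lift ord0 j) = cube (fun=> b) (fun=> b) (mu j) h.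

End cubes.

Section densities.
Variables (R : realType) (d dx : nat).
Local Notation Yt := 'rV[R]_d.
Local Notation Xt := 'rV[R]_dx.

Definition cond_prob (f : Yt -> Xt -> R) (A : set Yt) (x : Xt) : R :=
  \int[lebesgue_rV]_(y in A) f y x.

(* [f y x] is the conditional density f(y|x), [g] the density of the          *)
(* marginal of x with respect to [nu]. [f] is not required to vanish off Y:   *)
(* F(A|x) is only ever evaluated at subsets A of Y.                           *)
Record has_density (Y : set Yt) (X : set Xt)
    (F : probability (Yt * Xt)%type R) (f : Yt -> Xt -> R)
    (nu : {measure set Xt -> \bar R}) (g : Xt -> R) : Prop := HasDensity {
  has_density_measurableY : measurable Y ;
  has_density_measurableX : measurable X ;
  has_density_supp : F (Y `*` X) = 1%E ;
  has_density_cond_ge0 : forall y x, 0 <= f y x ;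
  has_density_cond_measurable :
    measurable_fun (Y `*` X) (fun z : Yt * Xt => f z.1 z.2) ;
  has_density_cond1 : forall x, X x ->
    (\int[lebesgue_rV]_(y in Y) (f y x)%:E = 1)%E ;
  has_density_marg_ge0 : forall x, 0 <= g x ;
  has_density_marg_measurable : measurable_fun X g ;
  has_density_marg : forall B, measurable B -> B `<=` X ->
    (F (Y `*` B) = \int[nu]_(x in B) (g x)%:E)%E ;
  has_density_disintegration : forall A B,
    measurable A -> A `<=` Y -> measurable B -> B `<=` X ->
    (F (A `*` B) = \int[nu]_(x in B) (cond_prob f A x * g x)%:E)%E
}.

(* [inve 0 = +oo] and [lne +oo = +oo], so the log-ratio is +oo when its       *)
(* denominator vanishes and its numerator does not.                           *)
Definition log_ratio (a b : R) : \bar R := lne (a%:E / b%:E)%E.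

Definition dKL (Y : set Yt) (X : set Xt) (F : probability (Yt * Xt)%type R)
    (f p : Yt -> Xt -> R) : \bar R :=
  (\int[F]_(z in Y `*` X) log_ratio (f z.1 z.2) (p z.1 z.2))%E.

Definition normal_density (y mu : Yt) (s : R) : R :=
  (Num.sqrt (2 * pi * s ^+ 2)) ^- d *
  expR (- (\sum_(i < d) (y 0 i - mu 0 i) ^+ 2) / (2 * s ^+ 2)).

Definition mixture m (w : 'I_m.+1 -> R) (mu : 'I_m -> Yt) (s s0 : R)
    (y : Yt) : R :=
  \sum_(j < m) w (lift ord0 j) * normal_density y (mu j) s +
  w ord0 * normal_density y 0 s0.

Definition poly_eval (P : mpoly.mpoly dx R) (x : Xt) : R :=
  mpoly.meval (fun i => x 0 i) P.

Definition softmax_weight m (P : 'I_m.+1 -> mpoly.mpoly dx R) (x : Xt)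
    (j : 'I_m.+1) : R :=
  expR (poly_eval (P j) x) / \sum_(k < m.+1) expR (poly_eval (P k) x).

Definition model0 (f : Yt -> Xt -> R) m (A : 'I_m.+1 -> set Yt)
    (mu : 'I_m -> Yt) (s s0 : R) (y : Yt) (x : Xt) : R :=
  mixture (fun j => cond_prob f (A j) x) mu s s0 y.

Definition model1 m (P : 'I_m.+1 -> mpoly.mpoly dx R) (mu : 'I_m -> Yt)
    (s s0 : R) (y : Yt) (x : Xt) : R :=
  mixture (softmax_weight P x) mu s s0 y.

End densities.

(* Main.v *)
From HB Require Import structures.
Require Import Defs.
From mathcomp Require Import all_boot all_order all_algebra.
From mathcomp Require Import all_classical all_reals all_analysis.
From mathcomp Require Import measurable_realfun.
From mathcomp Require Import ring lra.
From mathcomp Require mpoly.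

(** Write p0 and p1 for the densities of the models M_0 and M_1 at stage m.

    The sandwich.  The probabilities F(A_j|x), j = 0..m, sum to one, so moving
    their logarithms by less than eps and renormalizing multiplies each of them
    by a factor between exp(-2 eps) and exp(2 eps): one eps for the numerator
    and one for the normalizing sum ([softmax_weight_close]).  The mixtures
    inherit these factors, hence |ln p0 - ln p1| <= 2 eps everywhere, and this
    bound integrates against the probability F, infinite divergences included
    ([integral_le_shift], [dKL_shift]).  It remains to see that the divergence
    of M_0 tends to 0.

    The divergence is nonnegative by Gibbs' inequality ([dKL_ge0]), which rests
    on the mixture having total mass at most one and on F being the measure
    with density f with respect to the product of the Lebesgue measure and the
    law of x ([joint_density_measure]).  It is at most the integral of the
    positive part of ln (f / p0), and this integral tends to 0 by dominated
    convergence.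

    Pointwise limit.  The cells are small compared to sigma, because (b) forces
    h / sigma -> 0, and sigma is small compared to delta.  Almost every y is
    interior to Y and f is continuous there, so the cells contained in the cube
    of side delta around y have mass at least (f(y|x) - o(1)) h^d, and p0 is at
    least (f(y|x) - o(1)) times a Riemann sum of a Gaussian density over nearly
    all of its mass ([model0_ge_center], [model0_lower_limit]).

    Domination.  Let v be the infimum of f(.|x) over the cube C(r,y,x).  When y
    lies in a cell, the cells contained in the orthant C_1 at y carry a fixed
    fraction of the Gaussian mass, so p0 >= v * constant ([model0_ge_orthant]).
    When y lies in A_0, the component centered at 0 gives p0 >= v times a
    multiple of phi(y,0,sigma_0) ([model0_ge_rest]).  In both cases ln (f / p0)
    is at most ln (f / v), integrable by (e), plus a quadratic function of y,
    integrable by (d) ([log_ratio_domination]). *)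

Set Implicit Arguments.
Unset Strict Implicit.
Unset Printing Implicit Defensive.

Import Order.TTheory GRing.Theory Num.Theory.
Import numFieldNormedType.Exports.

Local Open Scope classical_set_scope.
Local Open Scope ring_scope.

(** * Integrals against a density and integrals of close functions *)

Section density_change.
Local Open Scope ereal_scope.
Context d (T : measurableType d) (R : realType).
Variables (mu M : {measure set T -> \bar R}) (w : T -> R).
Hypothesis mw : measurable_fun [set: T] w.
Hypothesis w0 : forall x, (0 <= w x)%R.
Hypothesis ME : forall S, measurable S -> M S = \int[mu]_(x in S) (w x)%:E.

Import HBNNSimple.

Let mwE : measurable_fun [set: T] (EFin \o w).
Proof. exact/measurable_EFinP. Qed.

(** The two sides agree on simple functions by linearity, and monotone
    convergence extends this to u.  The measure mu is arbitrary, so that the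
    lemma applies to the dominating measure of the law of x. *)
Lemma ge0_integral_density (u : T -> \bar R) :
  measurable_fun [set: T] u -> (forall x, 0 <= u x) ->
  \int[M]_x u x = \int[mu]_x (u x * (w x)%:E).
Proof.
move=> mu_ u0.
pose u_ := nnsfun_approx measurableT mu_.
have mu_n n : measurable_fun [set: T] (fun x => (u_ n x)%:E).
  exact/measurable_EFinP/measurable_funP.
have cvu x : EFin \o u_ ^~ x @ \oo --> u x by apply: cvg_nnsfun_approx.
transitivity (limn (fun n => \int[M]_x (u_ n x)%:E)).
  rewrite -monotone_convergence//.
  - by apply: eq_integral => x _; apply/esym/cvg_lim => //; exact: cvu.
  - by move=> n x _; rewrite lee_fin.
  - by move=> x _ m n mn; rewrite lee_fin; exact/lefP/nd_nnsfun_approx.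
transitivity (limn (fun n => \int[mu]_x ((u_ n x)%:E * (w x)%:E))); last first.
  rewrite -monotone_convergence//.
  - apply: eq_integral => x _; apply/cvg_lim => //.
    exact: cvgeZr (cvu x).
  - by move=> n; apply: emeasurable_funM.
  - by move=> n x _; rewrite mule_ge0 ?lee_fin.
  - move=> x _ m n mn; rewrite lee_wpmul2r ?lee_fin ?w0//.
    exact/lefP/nd_nnsfun_approx.
congr (limn _); apply/funext => n.
have mun r : measurable (u_ n @^-1` [set r]) by [].
transitivity (\sum_(k \in range (u_ n))
    \int[M]_x (k * \1_(u_ n @^-1` [set k]) x)%:E).
  under eq_integral do rewrite fimfunE -fsumEFin//.
  rewrite ge0_integral_fsum//.
  - by move=> y; exact/measurable_EFinP/measurable_funM.
  - by move=> y x _; rewrite nnfun_muleindic_ge0.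
transitivity (\sum_(k \in range (u_ n))
    \int[mu]_x ((k * \1_(u_ n @^-1` [set k]) x)%:E * (w x)%:E)); last first.
  rewrite -ge0_integral_fsum//.
  - apply: eq_integral => x _; rewrite -ge0_mule_fsuml; last first.
      by move=> k; rewrite nnfun_muleindic_ge0.
    by rewrite fsumEFin// -fimfunE.
  - move=> k; apply: emeasurable_funM => //.
    exact/measurable_EFinP/measurable_funM.
  - move=> k x _; rewrite mule_ge0 ?lee_fin//.
    by have := nnfun_muleindic_ge0 (u_ n) k x; rewrite -EFinM lee_fin.
apply: eq_fsbigr => k; rewrite inE => -[x _ <-].
rewrite integralZl_indic_nnsfun// integral_indic// setIT ME//.
rewrite integral_mkcond -ge0_integralZl//.
- apply: eq_integral => y _; rewrite patchE indicE EFinM -muleA; congr (_ * _).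
  by case: ifPn => _; rewrite ?mul1e ?mul0e.
- by apply/measurable_restrict => //; exact: measurable_funTS.
- by move=> y _; rewrite patchE; case: ifPn; rewrite ?lee_fin.
- by rewrite lee_fin.
Qed.

End density_change.

Section integral_shift.
Local Open Scope ereal_scope.
Context d (T : measurableType d) (R : realType).

Lemma funepos_le_shift (u v : T -> \bar R) (c : R) x : (0 <= c)%R ->
  u x <= v x + c%:E -> (u^\+) x <= (v^\+) x + c%:E.
Proof.
move=> c0 uv; rewrite !funepos.unlock ge_max; apply/andP; split.
  by rewrite (le_trans uv)// leeD2r// le_max lexx.
by rewrite adde_ge0 ?lee_fin// le_max lexx orbT.
Qed.

Lemma funeneg_le_shift (u v : T -> \bar R) (c : R) x : (0 <= c)%R ->
  v x <= u x + c%:E -> (u^\-) x <= (v^\-) x + c%:E.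
Proof.
move=> c0 vu; rewrite -!funeposN; apply: funepos_le_shift => //.
move: vu; case: (u x) (v x) => [a| |] [b| |]//=.
  by rewrite -!EFinD !lee_fin; lra.
all: by rewrite ?leey ?leNye.
Qed.

Variables (mu : {measure set T -> \bar R}) (D : set T).
Hypotheses (mD : measurable D) (muD : mu D <= 1).

(** The positive parts of u and v are within c of each other, and so are their
    negative parts, so the corresponding integrals are finite or infinite
    together.  If those of the negative parts are infinite then both sides are
    -oo; otherwise it suffices to integrate u^+ + v^- <= v^+ + u^- + c, an
    inequality between nonnegative functions. *)
Lemma integral_le_shift (u v : T -> \bar R) (c : R) :
  measurable_fun D u -> measurable_fun D v -> (0 <= c)%R ->
  (forall x, D x -> u x <= v x + c%:E) ->
  (forall x, D x -> v x <= u x + c%:E) ->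
  \int[mu]_(x in D) u x <= \int[mu]_(x in D) v x + c%:E.
Proof.
move=> mu_ mv c0 uv vu.
have mup := measurable_funepos mu_; have mun := measurable_funeneg mu_.
have mvp := measurable_funepos mv; have mvn := measurable_funeneg mv.
have intD (f : T -> \bar R) : measurable_fun D f -> (forall x, 0 <= f x) ->
    \int[mu]_(x in D) (f x + c%:E) <= \int[mu]_(x in D) f x + c%:E.
  move=> mf f0; rewrite ge0_integralD//.
  rewrite leeD2l// -[X in X <= _]/(\int[mu]_(x in D) (cst c%:E x)).
  by rewrite integral_cst// -[leRHS]mule1 lee_wpmul2l ?lee_fin.
rewrite (integralE _ _ u) (integralE _ _ v).
have pos (f g : T -> \bar R) : measurable_fun D f -> measurable_fun D g ->
    (forall x, 0 <= f x) -> (forall x, 0 <= g x) ->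
    (forall x, D x -> f x <= g x + c%:E) ->
    \int[mu]_(x in D) f x <= \int[mu]_(x in D) g x + c%:E.
  move=> mf mg f0 g0 fg; apply: le_trans (intD g mg g0).
  apply: ge0_le_integral => //.
  by apply: emeasurable_funD => //; exact: measurable_cst.
have /= unvn := pos _ _ mun mvn (funeneg_ge0 u) (funeneg_ge0 v)
  (fun x Dx => funeneg_le_shift c0 (vu x Dx)).
have /= vnun := pos _ _ mvn mun (funeneg_ge0 v) (funeneg_ge0 u)
  (fun x Dx => funeneg_le_shift c0 (uv x Dx)).
have [un_oo|un_fin] := eqVneq (\int[mu]_(x in D) u^\- x) +oo.
  by rewrite un_oo addeNy leNye.
have unf : \int[mu]_(x in D) u^\- x \is a fin_num.
  by rewrite ge0_fin_numE ?lt_neqAle ?un_fin ?leey ?integral_ge0.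
have vnf : \int[mu]_(x in D) v^\- x \is a fin_num.
  rewrite ge0_fin_numE ?integral_ge0//; apply: le_lt_trans vnun _.
  by apply: lte_add_pinfty; [rewrite ltey_eq unf|rewrite ltry].
have upvp : \int[mu]_(x in D) u^\+ x + \int[mu]_(x in D) v^\- x <=
    \int[mu]_(x in D) v^\+ x + \int[mu]_(x in D) u^\- x + c%:E.
  rewrite -!ge0_integralD//.
  apply: pos; [exact: emeasurable_funD|exact: emeasurable_funD| | |].
  - by move=> x; rewrite adde_ge0.
  - by move=> x; rewrite adde_ge0.
  move=> x Dx; have := uv x Dx; rewrite !funepos.unlock !funeneg.unlock.
  case: (u x) (v x) => [a| |] [b| |] //=; rewrite ?lee_fin => abc.
  - rewrite -!EFin_max -!EFinD lee_fin /Num.max.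
    by case: ifPn; case: ifPn; case: ifPn; case: ifPn => *; lra.
  all: rewrite ?(maxye, maxNye) -?EFin_max ?addey ?addye ?leey//; try discriminate.
move: upvp; rewrite -(fineK unf) -(fineK vnf).
have : 0 <= \int[mu]_(x in D) u^\+ x by rewrite integral_ge0.
have : 0 <= \int[mu]_(x in D) v^\+ x by rewrite integral_ge0.
case: (\int[mu]_(x in D) u^\+ x) => [a| |] // _;
  case: (\int[mu]_(x in D) v^\+ x) => [b| |] //= _;
  rewrite -?EFinB -?EFinD ?lee_fin ?leey//.
by lra.
Qed.

End integral_shift.

(** * Gaussian densities on R^n *)

Section gaussian.
Variable R : realType.

Lemma normal_density_gt0 n (y mu : 'rV[R]_n) s : 0 < s ->
  0 < normal_density y mu s.
Proof.
move=> s0; rewrite mulr_gt0 ?expR_gt0// invr_gt0 exprn_gt0// sqrtr_gt0.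
by rewrite !mulr_gt0 ?pi_gt0 ?exprn_gt0.
Qed.

Lemma normal_densityC n (y mu : 'rV[R]_n) s :
  normal_density y mu s = normal_density mu y s.
Proof.
rewrite /normal_density.
by under eq_bigr do rewrite -opprB sqrrN.
Qed.

Lemma measurable_normal_density n (mu : 'rV[R]_n) s :
  measurable_fun [set: 'rV[R]_n] (fun y => normal_density y mu s).
Proof.
apply: measurable_funM; first exact: measurable_cst.
apply: measurableT_comp; first exact: measurable_expR.
apply: measurable_funM; last exact: measurable_cst.
apply: measurableT_comp; first exact: oppr_measurable.
apply: measurable_sum => i; apply: measurable_funX.
by apply: measurable_funB; [exact: measurable_rV_coord|exact: measurable_cst].
Qed.

(** Splitting off the first coordinate, along which the measure [lebesgue_rV]
    is built. *)
Lemma normal_density_cons n (mu : 'rV[R]_n.+1) s a v : s != 0 ->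
  normal_density (rV_cons (a, v)) mu s =
  normal_pdf (mu 0 0) s a *
  normal_density v (\row_i mu 0 (lift ord0 i)) s.
Proof.
move=> s0; rewrite normal_pdfE// /normal_density /normal_peak.
rewrite /normal_fun big_ord_recl rV_consE unlift_none.
under eq_bigr do rewrite rV_consE liftK.
under [in RHS]eq_bigr do rewrite mxE.
rewrite [X in expR X]mulNr [X in expR (- X)]mulrDl opprD expRD exprS invfM.
rewrite -!mulNr (_ : s ^+ 2 * pi *+ 2 = 2 * pi * s ^+ 2); last first.
  by rewrite -mulr_natl; ring.
rewrite (_ : s ^+ 2 *+ 2 = 2 * s ^+ 2); last by rewrite -mulr_natl.
by rewrite mulrACA.
Qed.

Lemma integral_normal_density n (mu : 'rV[R]_n) s : 0 < s ->
  (\int[lebesgue_rV]_y (normal_density y mu s)%:E = 1)%E.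
Proof.
move=> s0; have sn0 : s != 0 by rewrite gt_eqF.
elim: n mu => [|n IH] mu.
  rewrite integral_dirac//; last first.
    by apply/measurable_EFinP; exact: measurable_normal_density.
  rewrite diracT mul1e /normal_density big_ord0 oppr0 mul0r expR0 mulr1.
  by rewrite expr0 invr1.
pose v := \row_i mu 0 (lift ord0 i).
have mE : measurable_fun [set: 'rV[R]_n.+1]
    (fun y => (normal_density y mu s)%:E).
  by apply/measurable_EFinP; exact: measurable_normal_density.
have nd0 (y : 'rV[R]_n.+1) : (0 <= (normal_density y mu s)%:E)%E.
  by rewrite lee_fin ltW// normal_density_gt0.
rewrite /= /lebesgue_rV_step ge0_integral_pushforward//; last first.
  exact: measurable_rV_cons.
rewrite preimage_setT fubini_tonelli1/=; [| |by move=> z; exact: nd0]; last first.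
  by apply: measurableT_comp => //; exact: measurable_rV_cons.
transitivity (\int[lebesgue_measure]_a (normal_pdf (mu 0 0) s a)%:E)%E.
  apply: eq_integral => a _; rewrite /fubini_F/=.
  transitivity (\int[lebesgue_rV]_w
      ((normal_pdf (mu 0 0) s a)%:E * (normal_density w v s)%:E))%E.
    by apply: eq_integral => w _; rewrite normal_density_cons.
  rewrite ge0_integralZl//= ?IH ?mule1//.
  - by apply/measurable_EFinP; exact: measurable_normal_density.
  - by move=> w _; rewrite lee_fin ltW// normal_density_gt0.
  - by rewrite lee_fin normal_pdf_ge0.
exact: integral_normal_pdf.
Qed.

(** Half of the exponent of the Gaussian is the exponent of the Gaussian with
    deviation sqrt 2 * s; outside of the box the other half is at most
    - t^2 / 4.  Tails are thus controlled by the total mass of a wider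
    Gaussian. *)
Lemma normal_density_tail n (y mu : 'rV[R]_n) (s t : R) : 0 < s -> 0 <= t ->
  ~ (forall i, `|y 0 i - mu 0 i| <= t * s) ->
  normal_density y mu s <= Num.sqrt 2 ^+ n * expR (- (t ^+ 2 / 4)) *
    normal_density y mu (Num.sqrt 2 * s).
Proof.
move=> s0 t0 /existsNP[i /negP]; rewrite -ltNge => tsi.
rewrite /normal_density exprMn sqr_sqrtr//.
rewrite (_ : 2 * pi * (2 * s ^+ 2) = 2 * (2 * pi * s ^+ 2)); last by ring.
rewrite [in leRHS]sqrtrM// exprMn.
set K := _ ^- n; set S := \sum_(_ < _) _.
rewrite [leRHS](_ : _ = K * (expR (- (t ^+ 2 / 4)) *
    expR (- S / (2 * (2 * s ^+ 2))))); last first.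
  have h : Num.sqrt 2 ^+ n != 0 :> R by rewrite expf_neq0// gt_eqF// sqrtr_gt0.
  rewrite invfM -/K !mulrA (mulrAC _ _ (Num.sqrt 2 ^+ n)^-1).
  by rewrite divff// mul1r (mulrC K).
rewrite ler_wpM2l//; first by rewrite invr_ge0 exprn_ge0.
rewrite -expRD ler_expR -subr_ge0.
have ss0 : 0 < s ^+ 2 by rewrite exprn_gt0.
rewrite (_ : _ - _ = (S - t ^+ 2 * s ^+ 2) / (4 * s ^+ 2)); last first.
  by field; rewrite gt_eqF.
rewrite divr_ge0//; last by rewrite mulr_ge0// ltW.
rewrite subr_ge0.
rewrite /S (bigD1 i)//= -exprMn -[leLHS]addr0 lerD//.
  by rewrite -[leRHS]real_normK ?num_real// ler_sqr ?nnegrE ?mulr_ge0// ltW.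
by apply: sumr_ge0 => j _; rewrite sqr_ge0.
Qed.

(** The closed cube of half side e, with a bound on distances in place of
    the interval endpoints of [cube]. *)
Definition box n (y : 'rV[R]_n) (e : R) :=
  [set z : 'rV[R]_n | forall i, `|z 0 i - y 0 i| <= e].

Lemma measurable_box n (y : 'rV[R]_n) (e : R) : measurable (box y e).
Proof.
rewrite (_ : box y e = \bigcap_(i in [set: 'I_n])
    ((fun v : 'rV[R]_n => v 0 i) @^-1` `[y 0 i - e, y 0 i + e]%classic));
    last first.
  apply/seteqP; split => z /= zy i.
    by move=> _; rewrite /= in_itv/= -ler_distl.
  by have /= := zy i Logic.I; rewrite in_itv/= -ler_distl.
apply: fin_bigcap_measurable => // i _.
by rewrite -[X in measurable X]setTI; exact: measurable_rV_coord.
Qed.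

Lemma integral_normal_density_box n (y : 'rV[R]_n) (s t : R) :
  0 < s -> 0 <= t ->
  ((1 - Num.sqrt 2 ^+ n * expR (- (t ^+ 2 / 4)))%:E <=
   \int[lebesgue_rV]_(z in box y (t * s)%R) (normal_density y z s)%:E)%E.
Proof.
move=> s0 t0.
have mn s' : measurable_fun [set: 'rV[R]_n]
    (fun z => (normal_density y z s')%:E).
  under eq_fun do rewrite normal_densityC.
  by apply/measurable_EFinP; exact: measurable_normal_density.
have n0 s' : 0 < s' -> forall z, [set: 'rV[R]_n] z ->
    (0 <= (normal_density y z s')%:E)%E.
  by move=> *; rewrite lee_fin ltW// normal_density_gt0.
have int1 s' : 0 < s' ->
    (\int[lebesgue_rV]_z (normal_density y z s')%:E = 1)%E.
  move=> s'0; under eq_integral do rewrite normal_densityC.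
  exact: integral_normal_density.
have mB := measurable_box y (t * s).
rewrite EFinB leeBlDr// -[leLHS](int1 s s0) -(setUv (box y (t * s))).
rewrite ge0_integral_setU//=; [|exact: measurableC|by rewrite setUv|
  by move=> z _; exact: n0|by apply/disj_setPCl].
rewrite leeD2l//.
set c := Num.sqrt 2 ^+ n * _.
have c0 : 0 <= c by rewrite mulr_ge0 ?expR_ge0 ?exprn_ge0.
have s2 : 0 < Num.sqrt 2 * s by rewrite mulr_gt0 ?sqrtr_gt0.
rewrite -[leRHS]mule1 -(int1 _ s2) -ge0_integralZl//; last exact: n0.
apply: le_trans (_ : \int[lebesgue_rV]_(z in ~` box y (t * s)%R)
    (c%:E * (normal_density y z (Num.sqrt 2 * s))%:E) <= _)%E.
  apply: ge0_le_integral => //.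
  - exact: measurableC.
  - by move=> z _; exact: n0.
  - exact: measurable_funTS.
  - by apply: measurable_funTS; exact: measurable_funeM.
  - move=> z /= zb; rewrite -EFinM lee_fin normal_densityC (normal_densityC y).
    by apply: normal_density_tail.
apply: ge0_subset_integral => //.
- exact: measurableC.
- exact: measurable_funeM.
- by move=> z _; rewrite mule_ge0// n0.
Qed.

End gaussian.

(** * Riemann sums of a Gaussian density over cubes *)

Section cube_facts.
Variables (R : realType) (n : nat).
Implicit Types (c z : 'rV[R]_n) (s h : R) (l r : 'I_n -> bool).

Lemma measurable_cube l r c s : measurable (cube l r c s).
Proof.
rewrite (_ : cube l r c s = \bigcap_(i in [set: 'I_n])
    ((fun v : 'rV[R]_n => v 0 i) @^-1`
      [set` Interval (BSide (l i) (c 0 i - s / 2)) (BSide (r i) (c 0 i + s / 2))])).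
  apply: fin_bigcap_measurable => // i _.
  by rewrite -[X in measurable X]setTI; exact: measurable_rV_coord.
by apply/seteqP; split => z /= zc i; [move=> _|]; exact: zc.
Qed.

Lemma lebesgue_rV_cube l r c s : 0 < s ->
  lebesgue_rV (cube l r c s) = (s ^+ n)%:E.
Proof.
move=> s0.
have := @lebesgue_rV_box R n (fun i => [set` Interval
  (BSide (l i) (c 0 i - s / 2)) (BSide (r i) (c 0 i + s / 2))]).
rewrite /cube => -> //.
rewrite (eq_bigr (fun=> s%:E)).
  transitivity (\prod_(i < n) s)%:E; last by rewrite prodr_const card_ord.
  by elim/big_rec2: _ => // i a b _ ->.
move=> i _; rewrite lebesgue_measure_itv/= lte_fin.
rewrite ifT; last by lra.
by rewrite -EFinB; congr EFin; lra.
Qed.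

Lemma cube_dist l r c s z i : cube l r c s z -> `|z 0 i - c 0 i| <= s / 2.
Proof.
move=> /(_ i); rewrite in_itv/= ler_distl => /andP[zl zr].
apply/andP; split.
  by move: zl; case: (l i) => //=; exact: ltW.
by move: zr; case: (r i) => //=; exact: ltW.
Qed.

End cube_facts.

Section cells.
Variables (R : realType) (n m : nat).
Variables (B : 'I_m -> set 'rV[R]_n) (c : 'I_m -> 'rV[R]_n) (h : R).
Hypothesis h0 : 0 <= h.
Hypothesis mB : forall j, measurable (B j).
Hypothesis BE : forall j, lebesgue_rV (B j) = (h ^+ n)%:E.
Hypothesis Bc : forall j z i, B j z -> `|z 0 i - c j 0 i| <= h / 2.

(** In each coordinate the distance from y to the center c of the cell exceeds
    the distance from y to z by at most h / 2, so its square exceeds by at most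
    h t s + h^2 / 4 <= (eta t + eta^2 / 4) s^2. *)
Lemma normal_density_center (y : 'rV[R]_n) (s t eta : R) j z : 0 < s ->
  0 <= t -> h <= eta * s -> box y (t * s) z -> B j z ->
  normal_density y z s <=
  expR (n%:R * (eta * t + eta ^+ 2 / 4) / 2) * normal_density y (c j) s.
Proof.
move=> s0 t0 heta yz Bz.
rewrite /normal_density [leRHS]mulrCA ler_wpM2l ?invr_ge0 ?exprn_ge0//.
rewrite -expRD ler_expR -subr_ge0.
set S := \sum_(i < n) (y 0 i - c j 0 i) ^+ 2.
set S' := \sum_(i < n) (y 0 i - z 0 i) ^+ 2.
have ss0 : 0 < s ^+ 2 by rewrite exprn_gt0.
have -> : n%:R * (eta * t + eta ^+ 2 / 4) / 2 + - S / (2 * s ^+ 2) -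
    - S' / (2 * s ^+ 2) =
    (S' + n%:R * ((eta * t + eta ^+ 2 / 4) * s ^+ 2) - S) / (2 * s ^+ 2).
  by field; rewrite gt_eqF.
rewrite divr_ge0//; last by rewrite mulr_ge0// ltW.
rewrite subr_ge0.
rewrite mulr_natl -[X in _ *+ X](card_ord n) -sumr_const -big_split/=.
apply: ler_sum => i _; rewrite -(real_normK (num_real (y 0 i - c j 0 i))).
rewrite -(real_normK (num_real (y 0 i - z 0 i))).
have yzi : `|y 0 i - z 0 i| <= t * s by rewrite distrC.
have zci := @Bc j z i Bz.
have yci : `|y 0 i - c j 0 i| <= `|y 0 i - z 0 i| + h / 2.
  rewrite (_ : y 0 i - c j 0 i = (y 0 i - z 0 i) + (z 0 i - c j 0 i));
    last by ring.
  by rewrite (le_trans (ler_normD _ _))// lerD2l.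
move: (normr_ge0 (y 0 i - z 0 i)) (normr_ge0 (y 0 i - c j 0 i)) yzi yci.
move: `|y 0 i - z 0 i| `|y 0 i - c j 0 i| => a b a0 b0 a1 ba.
apply: (@le_trans _ _ ((a + h / 2) ^+ 2)).
  by rewrite ler_sqr ?nnegrE//; lra.
rewrite -subr_ge0 (_ : _ - _ = (eta * s * (t * s) - h * a) +
  ((eta * s) ^+ 2 - h ^+ 2) / 4); last by field.
rewrite addr_ge0//.
  by rewrite subr_ge0 ler_pM.
by rewrite divr_ge0// subr_ge0 ler_sqr ?nnegrE// (le_trans h0).
Qed.

(** On each cell the density is at most its value at the center, up to a
    factor that tends to 1 with h / s for fixed t; the Riemann sum over cells
    that cover S therefore nearly bounds the integral over S. *)
Lemma integral_normal_density_cells (J : pred 'I_m) (S : set 'rV[R]_n)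
    (y : 'rV[R]_n) (s t eta : R) : 0 < s -> 0 <= t -> h <= eta * s ->
  measurable S -> S `<=` box y (t * s) ->
  (forall z, S z -> exists2 j, J j & B j z) ->
  (\int[lebesgue_rV]_(z in S) (normal_density y z s)%:E <=
   (expR (n%:R * (eta * t + eta ^+ 2 / 4) / 2) *
     \sum_(j | J j) h ^+ n * normal_density y (c j) s)%:E)%E.
Proof.
move=> s0 t0 heta mS Sbox SB; set K := expR _.
have K0 : 0 <= K by rewrite expR_ge0.
have nd0 (u v : 'rV[R]_n) : 0 <= normal_density u v s.
  by rewrite ltW// normal_density_gt0.
pose w j z : \bar R := ((K * normal_density y (c j) s)%:E * (\1_(B j) z)%:E)%E.
have w0 j z : (0 <= w j z)%E by rewrite mule_ge0// lee_fin mulr_ge0.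
have mw j : measurable_fun S (w j).
  apply: measurable_funTS; apply: measurable_funeM; apply/measurable_EFinP.
  exact: measurable_indic.
pose r := [seq j <- index_enum 'I_m | J j].
apply: (@le_trans _ _ (\int[lebesgue_rV]_(z in S) \sum_(j <- r) w j z)%E).
  apply: ge0_le_integral => //.
  - by move=> z _; rewrite lee_fin.
  - apply: measurable_funTS; under eq_fun do rewrite normal_densityC.
    by apply/measurable_EFinP; exact: measurable_normal_density.
  - exact: emeasurable_sum.
  - move=> z Sz; have [j Jj Bz] := SB z Sz.
    rewrite /r big_filter (bigD1 j)//=; apply: (@le_trans _ _ (w j z)).
      rewrite /w indicE mem_set// mule1 lee_fin.
      by apply: normal_density_center => //; exact: Sbox.
    by rewrite leeDl// sume_ge0.
rewrite ge0_integral_sum// /r big_filter mulr_sumr -sumEFin.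
have m1 j : measurable_fun S (fun z => (\1_(B j) z)%:E : \bar R).
  by apply: measurable_funTS; apply/measurable_EFinP; exact: measurable_indic.
apply: lee_sum => j _; rewrite ge0_integralZl ?lee_fin ?mulr_ge0//.
rewrite integral_indic//.
rewrite (mulrC (h ^+ n)).
move: (nd0 y (c j)); move: (normal_density y (c j) s) => e e0.
rewrite (mulrA K) [leRHS]EFinM.
rewrite lee_wpmul2l ?lee_fin ?mulr_ge0//.
apply: le_trans (_ : lebesgue_rV (B j) <= _)%E; last by rewrite BE.
by apply: le_measure; rewrite ?inE//; exact: measurableI.
Qed.

(** If the cells indexed by J have weights at least v times their volume, the
    mixture contains v times the Riemann sum of the previous lemma; the Gaussian
    density is symmetric in its two points, so this sum approximates an
    integral over the means. *)
Lemma mixture_ge_cells (J : pred 'I_m) (S : set 'rV[R]_n) (w : 'I_m.+1 -> R)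
    (y : 'rV[R]_n) (v s s0 t eta : R) : 0 < s -> 0 < s0 ->
  0 <= t -> h <= eta * s ->
  measurable S -> S `<=` box y (t * s) ->
  (forall z, S z -> exists2 j, J j & B j z) ->
  (forall j, 0 <= w j) -> 0 <= v ->
  (forall j, J j -> v * h ^+ n <= w (lift ord0 j)) ->
  ((v * expR (- (n%:R * (eta * t + eta ^+ 2 / 4) / 2)))%:E *
    \int[lebesgue_rV]_(z in S) (normal_density y z s)%:E <=
   (mixture w c s s0 y)%:E)%E.
Proof.
move=> s_0 s00 t0 heta mS Sbox SB w0 v0 vw.
have nd0 (u a : 'rV[R]_n) : 0 <= normal_density u a s.
  by rewrite ltW// normal_density_gt0.
apply: le_trans (lee_wpmul2l _
  (integral_normal_density_cells s_0 t0 heta mS Sbox SB)) _.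
  by rewrite lee_fin mulr_ge0 ?expR_ge0.
rewrite -EFinM lee_fin expRN; set K := expR _.
rewrite (mulrA (v / K)) divfK ?gt_eqF ?expR_gt0// mulr_sumr.
rewrite /mixture -[leLHS]addr0 lerD//; last first.
  by rewrite mulr_ge0// ltW// normal_density_gt0.
rewrite big_mkcond ler_sum// => j _; case: ifPn => Jj; last by rewrite mulr_ge0.
by rewrite mulrA ler_wpM2r// vw.
Qed.

End cells.

(** * The law F as a density with respect to a product measure *)

Section density_measure.
Local Open Scope ereal_scope.
Context d (T : measurableType d) (R : realType).

(** Countable additivity is the additivity of the integral over disjoint
    unions.  Bundling the result as a measure gives access to the uniqueness of
    measures that agree on a generating family. *)
Lemma measure_of_density (mu : {measure set T -> \bar R}) (w : T -> R) :
  measurable_fun [set: T] w -> (forall x, (0 <= w x)%R) ->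
  exists M : {measure set T -> \bar R},
    forall S, M S = \int[mu]_(x in S) (w x)%:E.
Proof.
move=> mw w0.
pose M0 S := \int[mu]_(x in S) (w x)%:E.
have M00 : M0 set0 = 0 by rewrite /M0 integral_set0.
have M0ge S : 0 <= M0 S by apply: integral_ge0 => x _; rewrite lee_fin.
have M0s : semi_sigma_additive M0.
  move=> S mS tS mUS.
  rewrite /M0 ge0_integral_bigcup//; last 2 first.
  - by apply: measurable_funTS; exact/measurable_EFinP.
  - by move=> x _; rewrite lee_fin.
  by apply: is_cvg_ereal_nneg_natsum => n _; exact: M0ge.
pose mix := isMeasure.Build _ T R M0 M00 M0ge M0s.
pose M : {measure set T -> \bar R} := HB.pack M0 mix.
by exists M.
Qed.

End density_measure.

Section joint_density.
Variables (R : realType) (d dx : nat).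
Local Notation Yt := 'rV[R]_d.
Local Notation Xt := 'rV[R]_dx.
Variables (Y : set Yt) (X : set Xt) (F : probability (Yt * Xt)%type R).
Variables (f : Yt -> Xt -> R) (nu : {measure set Xt -> \bar R}) (g : Xt -> R).
Hypothesis Ff : has_density Y X F f nu g.

Let mY : measurable Y := has_density_measurableY Ff.
Let mX : measurable X := has_density_measurableX Ff.
Let mYX : measurable (Y `*` X). Proof. exact: measurableX. Qed.

Let f0 y x : 0 <= f y x := has_density_cond_ge0 Ff y x.

Lemma measurable_section x : X x ->
  measurable_fun Y (fun y => (f y x)%:E).
Proof.
move=> Xx; apply/measurable_EFinP.
apply: (@measurable_comp _ _ _ _ _ _ (Y `*` X)
  (fun z : Yt * Xt => f z.1 z.2) _ (fun y => (y, x))) => //.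
- by move=> _ [y Yy <-].
- exact: has_density_cond_measurable Ff.
- by apply: measurable_funTS; exact: pair2_measurable.
Qed.

(** [cond_prob] is the real part of an integral in \bar R; the integral is at
    most 1, hence equal to its real part. *)
Lemma cond_prob_EFin A x : measurable A -> A `<=` Y -> X x ->
  ((cond_prob f A x)%:E = \int[lebesgue_rV]_(y in A) (f y x)%:E)%E.
Proof.
move=> mA AY Xx.
have mfx := measurable_section Xx.
rewrite /cond_prob /Rintegral fineK// ge0_fin_numE; last first.
  by apply: integral_ge0 => y _; rewrite lee_fin.
apply: (@le_lt_trans _ _ 1%E); last by rewrite ltry.
rewrite -(has_density_cond1 Ff Xx); apply: ge0_subset_integral => //.
by move=> y _; rewrite lee_fin.
Qed.

(** The set B inside A is where the lower bound v of the density is known: A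
    itself for the cells, the cube C_0 for the remainder A_0. *)
Lemma cond_prob_ge A B x (v b : R) : measurable A -> A `<=` Y ->
  measurable B -> B `<=` A -> X x -> lebesgue_rV B = b%:E -> 0 <= v ->
  (forall y, B y -> v <= f y x) -> v * b <= cond_prob f A x.
Proof.
move=> mA AY mB BA Xx Bb v0 vf; rewrite -lee_fin cond_prob_EFin// EFinM -Bb.
have mfx := measurable_section Xx.
apply: (@le_trans _ _ (\int[lebesgue_rV]_(y in B) (f y x)%:E)%E).
  rewrite -integral_cst//; apply: ge0_le_integral => //.
  by apply: measurable_funS mfx => //; exact: subset_trans AY.
apply: ge0_subset_integral => //; first exact: measurable_funS mfx.
by move=> y _; rewrite lee_fin.
Qed.

Lemma cond_prob_sum1 m (A : 'I_m.+1 -> set Yt) x :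
  (forall j, measurable (A j)) -> partition [set: 'I_m.+1] A Y -> X x ->
  \sum_j cond_prob f (A j) x = 1.
Proof.
move=> mA [Acov Atriv _] Xx; apply/eqP; rewrite -eqe -sumEFin.
have AY j : A j `<=` Y by rewrite -Acov => y Ay; exists j.
under eq_bigr do rewrite cond_prob_EFin//.
have YE : Y = \big[setU/set0]_(j <- index_enum 'I_m.+1) A j.
  rewrite -Acov -bigcup_seq /cover; congr (\bigcup_(j in _) A j).
  by apply/seteqP; split => j //= _; rewrite mem_index_enum.
rewrite -ge0_integral_bigsetU//.
- by rewrite -YE (has_density_cond1 Ff Xx).
- exact: index_enum_uniq.
- exact: sub_trivIset Atriv.
- by rewrite -YE; exact: measurable_section.
- by move=> y _; rewrite lee_fin.
Qed.

Lemma measure_support S : measurable S -> F S = F (S `&` (Y `*` X)).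
Proof.
move=> mS.
have nF : F (~` (Y `*` X)) = 0%E.
  by rewrite probability_setC// (has_density_supp Ff) subee.
rewrite -[in LHS](setIT S) -(setUv (Y `*` X)) setIUr measureU0//.
- exact: measurableI.
- by apply: measurableI => //; exact: measurableC.
- apply: subset_measure0 nF; [|exact: measurableC|exact: subIsetr].
  by apply: measurableI => //; exact: measurableC.
Qed.

Let sndX : {mfun (Yt * Xt)%type >-> Xt} :=
  HB.pack (@snd Yt Xt)
    (isMeasurableFun.Build _ _ _ _ _ (@measurable_snd _ _ Yt Xt)).

(* G is the law of x, with density gX with respect to nu.  The measure nu is
   arbitrary while G is finite, so Tonelli's theorem applies to products
   with G. *)
Let G : probability Xt R := distribution F sndX.

Let gX := g \_ X.

Let gX0 x : 0 <= gX x.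
Proof.
by rewrite /gX patchE; case: ifPn => // _; exact: has_density_marg_ge0 Ff x.
Qed.

Let mgX : measurable_fun [set: Xt] gX.
Proof.
by apply/(measurable_restrictT _ mX); exact: has_density_marg_measurable Ff.
Qed.

Let GE B : measurable B -> (G B = \int[nu]_(x in B) (gX x)%:E)%E.
Proof.
move=> mB; transitivity (F (Y `*` (B `&` X))).
  rewrite /G /= /distribution /pushforward measure_support; last first.
    by rewrite -[X in measurable X]setTI; exact: measurable_snd.
  by congr (F _); apply/seteqP; split => [[y x]/= [? []]|[y x]/= [? []]].
rewrite (has_density_marg Ff); [|exact: measurableI|exact: subIsetr].
rewrite integral_mkcondr; apply: eq_integral => x _.
by rewrite /gX !patchE; case: ifPn.
Qed.

Let fYX := (fun z : Yt * Xt => f z.1 z.2) \_ (Y `*` X).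

Let fYX0 z : 0 <= fYX z.
Proof. by rewrite /fYX patchE; case: ifPn. Qed.

Let mfYX : measurable_fun [set: Yt * Xt] fYX.
Proof.
by apply/(measurable_restrictT _ mYX); exact: has_density_cond_measurable Ff.
Qed.

(* On rectangles this is the disintegration of F: Tonelli's theorem turns the
   right-hand side into an integral over x of conditional probabilities, first
   against G and then, by [GE], against nu. *)
Let FE_rect A B : measurable A -> measurable B ->
  (F (A `*` B) = \int[lebesgue_rV \x G]_(z in A `*` B) (fYX z)%:E)%E.
Proof.
move=> mA mB; rewrite measure_support; last exact: measurableX.
rewrite -setXI (has_density_disintegration Ff); last 4 first.
- exact: measurableI.
- exact: subIsetr.
- exact: measurableI.
- exact: subIsetr.
have mAB : measurable (A `*` B) by exact: measurableX.
pose u := (EFin \o fYX) \_ (A `*` B).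
have mu_ : measurable_fun [set: Yt * Xt] u.
  by apply/(measurable_restrictT _ mAB)/measurable_funTS/measurable_EFinP.
have u0 z : (0 <= u z)%E by rewrite /u patchE; case: ifPn; rewrite ?lee_fin.
rewrite [RHS]integral_mkcond fubini_tonelli2//.
have mc := measurable_fun_fubini_tonelli_G (m1 := lebesgue_rV) u mu_ u0.
rewrite (ge0_integral_density mgX gX0 GE)//; last first.
  by move=> x; apply: integral_ge0.
rewrite [LHS]integral_mkcond; apply: eq_integral => x _.
rewrite patchE /fubini_G; case: ifPn => [|xBX].
  rewrite inE => -[Bx Xx]; rewrite EFinM.
  have -> := cond_prob_EFin (measurableI _ _ mA mY) (@subIsetr _ A Y) Xx.
  rewrite /gX patchE mem_set//; congr (_ * _)%E.
  rewrite [LHS]integral_mkcond.  apply: eq_integral => y _.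
  rewrite /u /fYX !patchE in_setI !in_setX/= (mem_set Bx) (mem_set Xx) !andbT.
  by case: (y \in A) => //=; case: (y \in Y).
rewrite integral0_eq ?mul0e// => y _.
rewrite /u /fYX /= !patchE !in_setX/=.
move: xBX; rewrite in_setI; case: (x \in B) => //=; last by rewrite andbF.
by move=> /negbTE ->; rewrite !andbF; case: ifP.
Qed.

(** Rectangles are stable under intersection and generate the product
    sigma-algebra, so agreement on them suffices. *)
Lemma joint_density_measure S : measurable S ->
  (F S = \int[lebesgue_rV \x G]_(z in S) (fYX z)%:E)%E.
Proof.
have [M ME] := measure_of_density (lebesgue_rV \x G)%E mfYX fYX0.
move=> mS; rewrite -ME.
pose C := [set A1 `*` A2 | A1 in @measurable _ Yt & A2 in @measurable _ Xt].
apply: (measure_unique C (fun=> setT)) => //.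
- by rewrite measurable_prod_measurableType.
- move=> _ _ [A1 mA1 [A2 mA2 <-]] [B1 mB1 [B2 mB2 <-]].
  exists (A1 `&` B1); first exact: measurableI.
  by exists (A2 `&` B2); [exact: measurableI|rewrite setXI].
- by move=> _; exists setT => //; exists setT => //; rewrite setXTT.
- by rewrite bigcup_const.
- by move=> _ [A1 mA1 [A2 mA2 <-]]; rewrite ME; exact: FE_rect.
- by move=> _; have := ltry (1 : R); rewrite -(@probability_setT _ _ _ F).
Qed.

Lemma measurable_cond_prob A : measurable A -> A `<=` Y ->
  measurable_fun X (cond_prob f A).
Proof.
move=> mA AY; have mAX : measurable (A `*` X) by exact: measurableX.
pose u := (fun z : Yt * Xt => (f z.1 z.2)%:E) \_ (A `*` X).
have mu_ : measurable_fun [set: Yt * Xt] u.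
  apply/(measurable_restrictT _ mAX)/measurable_EFinP.
  apply: measurable_funS (has_density_cond_measurable Ff) => //.
  by move=> z [] /AY.
have u0 z : (0 <= u z)%E by rewrite /u patchE; case: ifPn; rewrite ?lee_fin.
have mc := measurable_fun_fubini_tonelli_G (m1 := lebesgue_rV) u mu_ u0.
apply/measurable_EFinP.
apply: (eq_measurable_fun (fubini_G lebesgue_rV u)); last first.
  exact: measurable_funTS.
move=> x; rewrite inE => Xx; rewrite /= cond_prob_EFin//.
rewrite [RHS]integral_mkcond /fubini_G; apply: eq_integral => y _.
by rewrite /u !patchE in_setX/= (mem_set Xx) andbT.
Qed.

Lemma density_zero_null :
  F [set z | (Y `*` X) z /\ f z.1 z.2 = 0] = 0%E.
Proof.
have -> : [set z | (Y `*` X) z /\ f z.1 z.2 = 0] =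
    (Y `*` X) `&` [set z | fYX z = 0].
  apply/seteqP; split => z /= [Yz]; rewrite /fYX patchE mem_set//=.
have mS : measurable ((Y `*` X) `&` [set z | fYX z = 0]).
  apply: measurableI => //.
  rewrite -[X in measurable X]setTI.
  exact: (mfYX measurableT (measurable_set1 0)).
rewrite joint_density_measure//; apply: integral0_eq => z [_ /= ->] //.
Qed.

Lemma null_cylinder (N : set Yt) : measurable N -> lebesgue_rV N = 0%E ->
  F (N `*` setT) = 0%E.
Proof.
move=> mN N0; have mS : measurable (N `*` [set: Xt]) by exact: measurableX.
rewrite joint_density_measure//.
rewrite (eq_integral (fun z => `|(fYX z)%:E|%E)); last first.
  by move=> z _; rewrite gee0_abs ?lee_fin.
rewrite integral_abs_eq0//; first exact/measurable_funTS/measurable_EFinP.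
apply: etrans
  (@product_measure1E _ _ _ _ R lebesgue_rV G N setT mN measurableT) _.
by rewrite [X in (X * _)%E]N0 mul0e.
Qed.

(** The ratio p / f, written with logarithms to be visibly measurable,
    integrates against F = f dy G(dx) to at most the integral of p dy G(dx).
    Where f vanishes, so does the weight f of the ratio. *)
Lemma integral_likelihood_ratio_le1 (p : Yt -> Xt -> R) :
  measurable_fun (Y `*` X) (fun z : Yt * Xt => p z.1 z.2) ->
  (forall y x, X x -> 0 < p y x) ->
  (forall x, X x -> \int[lebesgue_rV]_(y in Y) (p y x)%:E <= 1)%E ->
  (\int[F]_(z in Y `*` X) (expR (ln (p z.1 z.2) - ln (f z.1 z.2)))%:E <= 1)%E.
Proof.
move=> mp p0 p1.
pose u := (fun z : Yt * Xt =>
  (expR (ln (p z.1 z.2) - ln (f z.1 z.2)))%:E) \_ (Y `*` X).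
pose v := (fun z : Yt * Xt => (p z.1 z.2)%:E) \_ (Y `*` X).
have mu_ : measurable_fun [set: Yt * Xt] u.
  apply/(measurable_restrictT _ mYX)/measurable_EFinP.
  apply: measurableT_comp => //; apply: measurable_funB.
    exact: measurableT_comp.
  by apply: measurableT_comp => //; exact: has_density_cond_measurable Ff.
have mv : measurable_fun [set: Yt * Xt] v.
  by apply/(measurable_restrictT _ mYX)/measurable_EFinP.
have u0 z : (0 <= u z)%E.
  by rewrite /u patchE; case: ifPn; rewrite ?lee_fin ?expR_ge0.
have v0 z : (0 <= v z)%E.
  rewrite /v patchE; case: ifPn => //; rewrite inE => -[_ Xz].
  by rewrite lee_fin ltW// p0.
rewrite integral_mkcond.
rewrite (ge0_integral_density mfYX fYX0 joint_density_measure)//.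
apply: (@le_trans _ _ (\int[lebesgue_rV \x G]_z v z)%E).
  apply: ge0_le_integral => //.
  - by move=> z _; rewrite mule_ge0 ?lee_fin.
  - by apply: emeasurable_funM => //; exact/measurable_EFinP.
  - move=> z _; rewrite /u /v /fYX !patchE; case: ifPn; last by rewrite mul0e.
    rewrite inE => -[_ Xz]; rewrite -EFinM lee_fin.
    have [->|fn0] := eqVneq (f z.1 z.2) 0.
      by rewrite mulr0 ltW// p0.
    have fz : 0 < f z.1 z.2 by rewrite lt_neqAle eq_sym fn0 f0.
    by rewrite expRB !lnK ?posrE ?p0// divfK.
rewrite fubini_tonelli2//.
apply: (@le_trans _ _ (\int[G]_x 1)%E); last first.
  by rewrite integral_cst// mul1e; have := probability_le1 G measurableT.
apply: ge0_le_integral => //.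
- by move=> x _; apply: integral_ge0.
- exact: measurable_fun_fubini_tonelli_G.
- move=> x _; rewrite /fubini_G.
  have [Xx|nXx] := pselect (X x).
    apply: le_trans (p1 x Xx); rewrite [leRHS]integral_mkcond le_eqVlt.
    apply/orP; left; apply/eqP; apply: eq_integral => y _.
    by rewrite /v !patchE in_setX/= (mem_set Xx) andbT.
  rewrite integral0_eq// => y _.
  by rewrite /v patchE in_setX/= (memNset nXx) andbF.
Qed.

End joint_density.

(** * Mixtures, softmax weights and the Kullback-Leibler divergence *)

Section log_ratio_facts.
Variable R : realType.
Implicit Types a b : R.

Lemma log_ratio_pos a b : 0 < a -> 0 < b ->
  log_ratio a b = (ln a - ln b)%:E.
Proof.
move=> a0 b0; rewrite /log_ratio inver gt_eqF// -EFinM lne_EFin ?divr_gt0//.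
by rewrite ln_div.
Qed.

Lemma log_ratio0l b : 0 < b -> log_ratio 0 b = -oo%E.
Proof. by move=> b0; rewrite /log_ratio mul0e /lne/= lexx. Qed.

Lemma log_ratio0r a : 0 < a -> log_ratio a 0 = +oo%E.
Proof. by move=> a0; rewrite /log_ratio inver eqxx gt0_muley. Qed.

End log_ratio_facts.

Section mixtures.
Variables (R : realType) (d dx : nat).
Local Notation Yt := 'rV[R]_d.
Local Notation Xt := 'rV[R]_dx.

Lemma mixture_gt0 m (w : 'I_m.+1 -> R) (mu : 'I_m -> Yt) s s0 y :
  0 < s -> 0 < s0 -> (forall j, 0 < w j) -> 0 < mixture w mu s s0 y.
Proof.
move=> s_gt0 s0_gt0 w0; rewrite ltr_wpDl//; last first.
  by rewrite mulr_gt0// normal_density_gt0.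
by apply: sumr_ge0 => j _; rewrite mulr_ge0// ltW// normal_density_gt0.
Qed.

(** Factors between weights pass to the mixtures, whose components are
    common and positive. *)
Lemma mixture_scale m (w w' : 'I_m.+1 -> R) (mu : 'I_m -> Yt) s s0 y (c : R) :
  0 < s -> 0 < s0 -> (forall j, w j <= c * w' j) ->
  mixture w mu s s0 y <= c * mixture w' mu s s0 y.
Proof.
move=> s_gt0 s0_gt0 ww'; rewrite /mixture mulrDr mulr_sumr.
apply: lerD; last by rewrite mulrA ler_wpM2r// ltW// normal_density_gt0.
by apply: ler_sum => j _; rewrite mulrA ler_wpM2r// ltW// normal_density_gt0.
Qed.

Lemma measurable_mixture m (X : set Xt) (Y : set Yt) (w : 'I_m.+1 -> Xt -> R)
    (mu : 'I_m -> Yt) s s0 :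
  measurable X -> measurable Y -> (forall j, measurable_fun X (w j)) ->
  measurable_fun (Y `*` X)
    (fun z : Yt * Xt => mixture (w ^~ z.2) mu s s0 z.1).
Proof.
move=> mX mY mw; have mYX : measurable (Y `*` X) by exact: measurableX.
have mwj j : measurable_fun (Y `*` X) (fun z : Yt * Xt => w j z.2).
  apply: (measurable_comp mX _ (mw j)); first by move=> _ [[y x] [_ Xx] <-].
  by apply: measurable_funTS; exact: measurable_snd.
have mn c t : measurable_fun (Y `*` X)
    (fun z : Yt * Xt => normal_density z.1 c t).
  apply: measurable_funTS.
  exact: (measurableT_comp (measurable_normal_density c t)
    (@measurable_fst _ _ Yt Xt)).
rewrite /mixture.
have h2 : measurable_fun (Y `*` X)
    (fun z : Yt * Xt => w ord0 z.2 * normal_density z.1 0 s0).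
  exact: (measurable_funM (mwj _) (mn _ _)).
have h1 : measurable_fun (Y `*` X) (fun z : Yt * Xt =>
    \sum_(j < m) w (lift ord0 j) z.2 * normal_density z.1 (mu j) s).
  by apply: measurable_sum => j; exact: (measurable_funM (mwj _) (mn _ _)).
exact: (measurable_funD h1 h2).
Qed.

(** Each component has total mass one over the whole space. *)
Lemma integral_mixture_le1 m (Y : set Yt) (w : 'I_m.+1 -> R)
    (mu : 'I_m -> Yt) s s0 : measurable Y -> 0 < s -> 0 < s0 ->
  (forall j, 0 <= w j) -> \sum_j w j = 1 ->
  (\int[lebesgue_rV]_(y in Y) (mixture w mu s s0 y)%:E <= 1)%E.
Proof.
move=> mY s_gt0 s0_gt0 w0 w1.
have nd0 (u a : Yt) t : 0 < t -> 0 <= normal_density u a t.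
  by move=> t0; rewrite ltW// normal_density_gt0.
have mn (c : Yt) t : measurable_fun [set: Yt]
    (fun y => (normal_density y c t)%:E).
  by apply/measurable_EFinP; exact: measurable_normal_density.
pose F j (y : Yt) : \bar R :=
  ((w (lift ord0 j))%:E * (normal_density y (mu j) s)%:E)%E.
have F0 j y : (0 <= F j y)%E by rewrite /F -EFinM lee_fin mulr_ge0// nd0.
have mF j : measurable_fun [set: Yt] (F j) by exact: measurable_funeM.
pose F' (y : Yt) : \bar R := ((w ord0)%:E * (normal_density y 0 s0)%:E)%E.
have F'0 y : (0 <= F' y)%E by rewrite /F' -EFinM lee_fin mulr_ge0// nd0.
have mF' : measurable_fun [set: Yt] F' by exact: measurable_funeM.
have E y : (mixture w mu s s0 y)%:E = (\sum_(j < m) F j y + F' y)%E.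
  by rewrite /mixture EFinD EFinM -sumEFin; under eq_bigr do rewrite EFinM.
have mS : measurable_fun [set: Yt] (fun y => \sum_(j < m) F j y)%E.
  exact: emeasurable_sum.
apply: (@le_trans _ _ (\int[lebesgue_rV]_y (\sum_(j < m) F j y + F' y))%E).
  under eq_integral do rewrite E.
  apply: ge0_subset_integral => //; first exact: emeasurable_funD.
  by move=> y _; rewrite adde_ge0// sume_ge0.
rewrite ge0_integralD//; last by move=> y _; rewrite sume_ge0.
rewrite ge0_integral_sum//.
rewrite /F' ge0_integralZl ?lee_fin//; last by move=> y _; rewrite lee_fin nd0.
rewrite integral_normal_density// mule1.
under eq_bigr => j _.
  rewrite /F ge0_integralZl ?lee_fin//; last by move=> y _; rewrite lee_fin nd0.
  rewrite integral_normal_density// mule1; over.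
by rewrite sumEFin -EFinD addrC -(big_ord_recl m w) w1.
Qed.

Lemma measurable_poly_eval (P : mpoly.mpoly dx R) :
  measurable_fun [set: Xt] (poly_eval P).
Proof.
rewrite /poly_eval; under eq_fun do rewrite mpoly.mevalE.
apply: measurable_sum => k; apply: measurable_funM => //.
apply: measurable_prod => i _; apply: measurable_funX.
exact: measurable_rV_coord.
Qed.

Lemma measurable_softmax_weight m (P : 'I_m.+1 -> mpoly.mpoly dx R) j :
  measurable_fun [set: Xt] (fun x => softmax_weight P x j).
Proof.
have -> : (fun x => softmax_weight P x j) = (fun x =>
    expR (poly_eval (P j) x - ln (\sum_(k < m.+1) expR (poly_eval (P k) x)))).
  apply/funext => x; rewrite expRB lnK// posrE big_ord_recl.
  rewrite ltr_wpDr ?expR_gt0//.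
  by apply: sumr_ge0 => k _; rewrite expR_ge0.
apply: measurableT_comp => //; apply: measurable_funB.
  exact: measurable_poly_eval.
apply: measurableT_comp => //; apply: measurable_sum => k.
by apply: measurableT_comp => //; exact: measurable_poly_eval.
Qed.

Lemma softmax_weight_gt0 m (P : 'I_m.+1 -> mpoly.mpoly dx R) x j :
  0 < softmax_weight P x j.
Proof.
rewrite divr_gt0 ?expR_gt0// big_ord_recl ltr_wpDr ?expR_gt0//.
by apply: sumr_ge0 => k _; rewrite expR_ge0.
Qed.

(** One factor exp(e) comes from the numerator, the other from the normalizing
    sum D: since the w j sum to one, exp(-e) <= D <= exp(e). *)
Lemma softmax_weight_close m (P : 'I_m.+1 -> mpoly.mpoly dx R) (x : Xt)
    (w : 'I_m.+1 -> R) (e : R) : (forall j, 0 < w j) -> \sum_j w j = 1 ->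
  (forall j, `|ln (w j) - poly_eval (P j) x| < e) ->
  forall j, softmax_weight P x j <= expR (2 * e) * w j /\
            w j <= expR (2 * e) * softmax_weight P x j.
Proof.
move=> w0 w1 we j; rewrite /softmax_weight; set D := \sum_(k < m.+1) _.
have D0 : 0 < D.
  rewrite /D big_ord_recl ltr_wpDr ?expR_gt0//.
  by apply: sumr_ge0 => k _; rewrite expR_ge0.
have up k : expR (poly_eval (P k) x) <= expR e * w k.
  rewrite -[w k]lnK ?posrE// -expRD ler_expR.
  by have := ltW (we k); rewrite ler_distlC => /andP[_]; rewrite addrC.
have dn k : w k <= expR e * expR (poly_eval (P k) x).
  rewrite -[w k]lnK ?posrE// -expRD ler_expR.
  by have := ltW (we k); rewrite ler_distl => /andP[_]; rewrite addrC.
have Du : D <= expR e.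
  by rewrite -[leRHS]mulr1 -w1 mulr_sumr; apply: ler_sum => k _.
have Dd : 1 <= expR e * D.
  by rewrite -w1 mulr_sumr; apply: ler_sum => k _.
have e2 : expR (2 * e) = expR e * expR e by rewrite -expRD; congr expR; ring.
split.
  rewrite ler_pdivrMr// e2 (le_trans (up j))//.
  by rewrite -!mulrA ler_wpM2l ?expR_ge0// mulrCA ler_peMr// ltW.
rewrite mulrA ler_pdivlMr// e2 (le_trans (ler_wpM2r (ltW D0) (dn j)))//.
by rewrite (mulrAC _ _ D) !(ler_wpM2r, ler_wpM2l) ?expR_ge0.
Qed.

End mixtures.

Section kullback_leibler.
Variables (R : realType) (d dx : nat).
Local Notation Yt := 'rV[R]_d.
Local Notation Xt := 'rV[R]_dx.
Variables (Y : set Yt) (X : set Xt) (F : probability (Yt * Xt)%type R).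
Variables (f : Yt -> Xt -> R) (nu : {measure set Xt -> \bar R}) (g : Xt -> R).
Hypothesis Ff : has_density Y X F f nu g.

Let mY : measurable Y := has_density_measurableY Ff.
Let mX : measurable X := has_density_measurableX Ff.
Let mYX : measurable (Y `*` X). Proof. exact: measurableX. Qed.
Let f0 y x : 0 <= f y x := has_density_cond_ge0 Ff y x.
Let mf := has_density_cond_measurable Ff.

Let FYX : (F (Y `*` X) <= 1)%E.
Proof. exact: probability_le1. Qed.

(** F has density f, so it gives no mass to the zeros of f. *)
Lemma ae_density_gt0 :
  {ae F, forall z : Yt * Xt, (Y `*` X) z -> 0 < f z.1 z.2}.
Proof.
exists [set z | (Y `*` X) z /\ f z.1 z.2 = 0]; split.
- exact: (mf mYX (measurable_set1 0)).
- exact: density_zero_null Ff.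
- move=> z /= /not_implyP[Dz] /negP; rewrite -leNgt => fz.
  by split => //; apply/eqP; rewrite eq_le fz f0.
Qed.

Section one_model.
Variable p : Yt -> Xt -> R.
Hypothesis mp : measurable_fun (Y `*` X) (fun z : Yt * Xt => p z.1 z.2).
Hypothesis p0 : forall y x, X x -> 0 < p y x.

Lemma measurable_log_difference : measurable_fun (Y `*` X)
  (fun z : Yt * Xt => (ln (f z.1 z.2) - ln (p z.1 z.2))%:E).
Proof.
apply/measurable_EFinP/measurable_funB.
  by apply: measurableT_comp => //; exact: mf.
exact: measurableT_comp.
Qed.

(** The extended log-ratio differs from the difference of logarithms only
    where f vanishes, which is F-negligible. *)
Lemma dKLE : dKL Y X F f p =
  (\int[F]_(z in Y `*` X) (ln (f z.1 z.2) - ln (p z.1 z.2))%:E)%E.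
Proof.
have ml := measurable_log_difference.
apply: ae_eq_integral => //; last first.
  apply: filterS ae_density_gt0 => z fz Dz.
  by rewrite log_ratio_pos ?fz// p0//; case: Dz.
pose S0 := (Y `*` X) `&` (fun z : Yt * Xt => f z.1 z.2) @^-1` [set 0].
have mS0 : measurable S0 by exact: (mf mYX (measurable_set1 0)).
(* Adding -oo times an indicator gives the value -oo where f vanishes and
   changes nothing elsewhere, as -oo * 0 = 0. *)
apply: (eq_measurable_fun (fun z : Yt * Xt =>
    (ln (f z.1 z.2) - ln (p z.1 z.2))%:E + -oo * (\1_S0 z)%:E)%E); last first.
  apply: emeasurable_funD => //; apply: emeasurable_funM => //.
  exact/measurable_funTS/measurable_EFinP/measurable_indic.
move=> z; rewrite inE => Dz; have [_ Xz] := Dz.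
have pz := p0 z.1 Xz; rewrite indicE.
have [fz|fz] := eqVneq (f z.1 z.2) 0.
  rewrite mem_set; last by split.
  by rewrite fz log_ratio0l// mule1.
rewrite memNset/=; last by case=> _ /= /eqP; apply/negP.
by rewrite mule0 adde0 log_ratio_pos// lt_neqAle eq_sym fz f0.
Qed.

Lemma dKL_le_funepos : (dKL Y X F f p <=
  \int[F]_(z in Y `*` X) (Num.max (ln (f z.1 z.2) - ln (p z.1 z.2)) 0)%:E)%E.
Proof.
rewrite dKLE integralE; set A := (X in (X - _ <= _)%E).
have -> : A = (\int[F]_(z in Y `*` X)
    (Num.max (ln (f z.1 z.2) - ln (p z.1 z.2)) 0)%:E)%E.
  by apply: eq_integral => z _; rewrite funepos.unlock EFin_max.
by rewrite -[leRHS]adde0 leeD2l// oppe_le0 integral_ge0.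
Qed.

(** Gibbs' inequality, from exp(- t) >= 1 - t with t = ln f - ln p.  It is
    integrated in the form 1 + t^- <= t^+ + exp(- t), between nonnegative
    functions; the integral of exp(- t) is at most 1, which also shows that the
    integral of t^- is finite. *)
Lemma dKL_ge0 :
  (forall x, X x -> \int[lebesgue_rV]_(y in Y) (p y x)%:E <= 1)%E ->
  (0 <= dKL Y X F f p)%E.
Proof.
move=> p1; rewrite dKLE integralE.
have ml := measurable_log_difference.
set u := (fun z => _) in ml *.
pose v (z : Yt * Xt) := (expR (ln (p z.1 z.2) - ln (f z.1 z.2)))%:E.
have mv : measurable_fun (Y `*` X) v.
  apply/measurable_EFinP; apply: measurableT_comp => //; apply: measurable_funB.
    exact: measurableT_comp.
  by apply: measurableT_comp => //; exact: mf.
have v0 z : (0 <= v z)%E by rewrite lee_fin expR_ge0.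
have mup := measurable_funepos ml; have mun := measurable_funeneg ml.
have v1 : (\int[F]_(z in Y `*` X) v z <= 1)%E.
  exact: (integral_likelihood_ratio_le1 Ff mp p0 p1).
have key z : (1 + u^\- z <= u^\+ z + v z)%E.
  rewrite funepos.unlock funeneg.unlock /u /v -!EFin_max -!EFinD lee_fin.
  set t := ln (f _ _) - _; have -> : ln (p z.1 z.2) - ln (f z.1 z.2) = - t.
    by rewrite opprB.
  have := expR_ge1Dx (- t); rewrite /Num.max.
  by case: ifPn; case: ifPn => *; lra.
have FYX1 : F (Y `*` X) = 1%E := has_density_supp Ff.
have ukey : (1 + \int[F]_(z in Y `*` X) u^\- z <=
    \int[F]_(z in Y `*` X) u^\+ z + \int[F]_(z in Y `*` X) v z)%E.
  rewrite -ge0_integralD//.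
  apply: (@le_trans _ _ (\int[F]_(z in Y `*` X) (1 + u^\- z))%E).
    rewrite ge0_integralD// leeD2r//.
    rewrite -[leRHS]/(\int[F]_(z in Y `*` X) (cst 1%E z))%E integral_cst//.
    by rewrite mul1e [leRHS]FYX1.
  apply: ge0_le_integral => //.
  - by move=> z _; rewrite adde_ge0.
  - exact: emeasurable_funD.
  - exact: emeasurable_funD.
have unf : (\int[F]_(z in Y `*` X) u^\- z)%E \is a fin_num.
  rewrite ge0_fin_numE ?integral_ge0//.
  apply: (@le_lt_trans _ _ 1%E); last by rewrite ltry.
  apply: le_trans v1; apply: ge0_le_integral => // z _.
  rewrite funeneg.unlock /u /v -!EFin_max lee_fin.
  rewrite ge_max expR_ge0 andbT opprB.
  by have := expR_ge1Dx (ln (p z.1 z.2) - ln (f z.1 z.2)); lra.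
rewrite sube_ge0 ?unf//.
rewrite -(leeD2lE (x := 1%E))// (le_trans ukey)// addeC leeD2r//.
Qed.

End one_model.

Lemma dKL_shift (p q : Yt -> Xt -> R) (c : R) :
  measurable_fun (Y `*` X) (fun z : Yt * Xt => p z.1 z.2) ->
  measurable_fun (Y `*` X) (fun z : Yt * Xt => q z.1 z.2) ->
  (forall y x, X x -> 0 < p y x) -> (forall y x, X x -> 0 < q y x) ->
  0 <= c -> (forall y x, X x -> `|ln (p y x) - ln (q y x)| <= c) ->
  (dKL Y X F f p <= dKL Y X F f q + c%:E)%E.
Proof.
move=> mp mq p0 q0 c0 pq; rewrite !dKLE//.
apply: integral_le_shift => //.
- exact: measurable_log_difference.
- exact: measurable_log_difference.
- move=> z [_ Xz]; rewrite -EFinD lee_fin.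
  by have := pq z.1 z.2 Xz; rewrite ler_distl => /andP[]; lra.
- move=> z [_ Xz]; rewrite -EFinD lee_fin.
  by have := pq z.1 z.2 Xz; rewrite ler_distl => /andP[]; lra.
Qed.

End kullback_leibler.

(** * Cubic partitions *)

Section cubic_partitions.
Variables (R : realType) (n : nat).
Local Notation Yt := 'rV[R]_n.
Variables (Y : set Yt) (h : R) (m : nat) (A : 'I_m.+1 -> set Yt)
  (mu : 'I_m -> Yt).
Hypothesis mY : measurable Y.
Hypothesis h0 : 0 < h.
Hypothesis YA : cubic_partition Y h A mu.

Lemma cell_sub j : A j `<=` Y.
Proof. by case: YA => [[YE _ _] _] y Ay; rewrite -YE; exists j. Qed.

Lemma cellE : exists b, forall j,
  A (lift ord0 j) = cube (fun=> b) (fun=> b) (mu j) h.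
Proof. by case: YA => [_ [b [ o [k bE]]]]; exists b => j; have [] := bE j. Qed.

Lemma measurable_cell j : measurable (A (lift ord0 j)).
Proof. by have [b ->] := cellE; exact: measurable_cube. Qed.

Lemma lebesgue_cell j : lebesgue_rV (A (lift ord0 j)) = (h ^+ n)%:E.
Proof. by have [b ->] := cellE; exact: lebesgue_rV_cube. Qed.

Lemma cell_dist j z i : A (lift ord0 j) z -> `|z 0 i - mu j 0 i| <= h / 2.
Proof. by have [b ->] := cellE; exact: cube_dist. Qed.

Lemma cell_cover y : Y y -> ~ A ord0 y -> exists j, A (lift ord0 j) y.
Proof.
case: YA => [[YE _ _] _]; rewrite -YE => -[i _ Ai] nA0.
by case: (unliftP ord0 i) Ai => [j ->|->]//; exists j.
Qed.

Lemma measurable_rest : measurable (A ord0).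
Proof.
have -> : A ord0 = Y `\` \big[setU/set0]_(j < m) A (lift ord0 j).
  apply/seteqP; split => y.
    move=> A0y; split; first exact: cell_sub A0y.
    rewrite -bigcup_seq => -[j _ Ajy]; case: YA => [[_ tA _] _].
    by have := tA ord0 (lift ord0 j) I I (ex_intro _ y (conj A0y Ajy)).
  move=> [Yy nAy]; apply: contrapT => nA0; have [j Aj] := cell_cover Yy nA0.
  by apply: nAy; rewrite -bigcup_seq; exists j => //=; rewrite mem_index_enum.
apply: measurableD => //; apply: bigsetU_measurable => j _.
exact: measurable_cell.
Qed.

Lemma measurable_part j : measurable (A j).
Proof.
case: (unliftP ord0 j) => [i ->|->]; first exact: measurable_cell.
exact: measurable_rest.
Qed.

(** Off its faces a half-open cube is a neighbourhood of its points. *)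
Lemma open_cell_interior j (y : Yt) :
  (forall i, `|y 0 i - mu j 0 i| < h / 2) ->
  exists2 e : R, 0 < e & forall z : Yt, (forall i, `|z 0 i - y 0 i| < e) -> Y z.
Proof.
move=> yj.
pose e := \big[Num.min/1]_(i < n) (h / 2 - `|y 0 i - mu j 0 i|).
exists e; first by apply: lt_bigmin => // i _; rewrite subr_gt0.
move=> z zy; apply: (@cell_sub (lift ord0 j)).
have [b ->] := cellE => i; rewrite in_itv/=.
have : `|z 0 i - mu j 0 i| < h / 2.
  rewrite (_ : z 0 i - mu j 0 i = (z 0 i - y 0 i) + (y 0 i - mu j 0 i));
    last by ring.
  rewrite (le_lt_trans (ler_normD _ _))// -ltrBrDr (lt_le_trans (zy i))//.
  exact: bigmin_le_cond.
rewrite ltr_distl => /andP[zl zr].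
by case: b => /=; rewrite ?(ltW zl) ?(ltW zr) ?zl ?zr.
Qed.

End cubic_partitions.

Lemma lebesgue_hyperplane0 (R : realType) n (i : 'I_n) (a : R) :
  lebesgue_rV [set z : 'rV[R]_n | z 0 i = a] = 0%E.
Proof.
have -> : [set z : 'rV[R]_n | z 0 i = a] = [set z | forall k,
    (if k == i then [set a] else [set: R]) (z 0 k)].
  apply/seteqP; split => z /= => [<- k|/(_ i)]; last by rewrite eqxx.
  by case: eqP => [->|].
have -> := @lebesgue_rV_box R n (fun k => if k == i then [set a] else setT);
  last by move=> k; case: ifP.
by rewrite (bigD1 i)//= eqxx lebesgue_measure_set1 mul0e.
Qed.

Lemma measurable_hyperplane (R : realType) n (i : 'I_n) (a : R) :
  measurable [set z : 'rV[R]_n | z 0 i = a].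
Proof.
by have := @measurable_rV_coord R n i measurableT _ (measurable_set1 a);
  rewrite setTI.
Qed.

(** By (a) each point of Y eventually leaves A_0, hence lies in some half-open
    cube contained in Y; it is interior to Y unless it lies on a face of that
    cube.  The faces lie in countably many hyperplanes. *)
Lemma not_interior_null (R : realType) (n : nat) (Y : set 'rV[R]_n)
  (h delta : nat -> R)
  (A : forall m, 'I_m.+1 -> set 'rV[R]_n) (mu : forall m, 'I_m -> 'rV[R]_n) :
  (forall m, 0 < delta m) ->
  (forall m, cubic_partition Y (h m) (A m) (mu m)) ->
  (forall y, Y y -> exists M0, forall m, (M0 <= m)%N ->
    closed_cube y (delta m) `&` A m ord0 = set0) ->
  exists N : set 'rV[R]_n,
  [/\ measurable N, lebesgue_rV N = 0%E & forall y, Y y -> ~ N y ->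
    exists2 e : R, 0 < e &
      forall z : 'rV[R]_n, (forall i, `|z 0 i - y 0 i| < e) -> Y z].
Proof.
move=> delta0 YA fine.
pose faces m := \bigcup_(j in [set: 'I_m]) \bigcup_(i in [set: 'I_n])
  ([set z : 'rV[R]_n | z 0 i = mu m j 0 i - h m / 2] `|`
   [set z : 'rV[R]_n | z 0 i = mu m j 0 i + h m / 2]).
have nfin (T : finType) (G : T -> set 'rV[R]_n) :
    (forall t, lebesgue_rV.-negligible (G t)) ->
    lebesgue_rV.-negligible (\bigcup_(t in [set: T]) G t).
  move=> nG; have -> : \bigcup_(t in [set: T]) G t =
      \big[setU/set0]_(t <- index_enum T) G t.
    rewrite -bigcup_seq; congr (\bigcup_(t in _) G t).
    by apply/seteqP; split => t //= _; rewrite mem_index_enum.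
  elim/big_ind: _ => [|U V nU nV|t _]; [exact: negligible_set0| |exact: nG].
  exact: negligibleU.
have nhyp i a : lebesgue_rV.-negligible [set z : 'rV[R]_n | z 0 i = a].
  exists [set z : 'rV[R]_n | z 0 i = a]; split => //.
  - exact: measurable_hyperplane.
  - exact: lebesgue_hyperplane0.
have /negligible_bigcup [N [mN N0 NF]] :
    forall m, lebesgue_rV.-negligible (faces m).
  by move=> m; apply: (nfin) => j; apply: (nfin) => i; exact: negligibleU.
exists N; split => // y Yy Ny; have [m /(_ m (leqnn m)) ym] := fine y Yy.
have nA0 : ~ A m ord0 y.
  move=> A0y; suff : (closed_cube y (delta m) `&` A m ord0) y by rewrite ym.
  split => // i; rewrite in_itv/= lerBlDr lerDl.
  by rewrite divr_ge0 ?ltW//= lerDl divr_ge0// ltW.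
have [j Aj] := cell_cover (YA m) Yy nA0.
apply: (open_cell_interior (YA m) (j := j)) => i.
have yji := cell_dist (YA m) i Aj.
rewrite lt_neqAle yji andbT; apply/eqP => yE; apply: Ny; apply: NF.
exists m => //; exists j => //; exists i => //=.
have [yp|yn] := lerP 0 (y 0 i - mu m j 0 i).
  by right; move: yE; rewrite ger0_norm// => <-; rewrite addrC subrK.
by left; move: yE; rewrite ltr0_norm// => <-; rewrite opprK addrC subrK.
Qed.

(** * Lower bounds for the mixture with weights F(A_j|x) *)

Lemma normal_density_box_ge (R : realType) n (y z : 'rV[R]_n) (s t : R) :
  0 < s -> 0 <= t -> box y (t * s) z ->
  Num.sqrt (2 * pi * s ^+ 2) ^- n * expR (- (n%:R * t ^+ 2 / 2)) <=
  normal_density y z s.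
Proof.
move=> s0 t0 yz; rewrite /normal_density ler_wpM2l ?invr_ge0 ?exprn_ge0//.
have ss0 : 0 < s ^+ 2 by rewrite exprn_gt0.
rewrite ler_expR mulNr lerN2 ler_pdivrMr ?mulr_gt0//.
rewrite (_ : n%:R * t ^+ 2 / 2 * (2 * s ^+ 2) = n%:R * (t * s) ^+ 2);
  last by field.
rewrite mulr_natl -[X in _ *+ X](card_ord n) -sumr_const.
apply: ler_sum => i _; rewrite -(real_normK (num_real (y 0 i - z 0 i))).
by rewrite ler_sqr ?nnegrE ?mulr_ge0 ?(ltW s0)// distrC; exact: yz.
Qed.

Section model0_lower_bounds.
Variables (R : realType) (d dx : nat).
Local Notation Yt := 'rV[R]_d.
Local Notation Xt := 'rV[R]_dx.
Variables (Y : set Yt) (X : set Xt) (F : probability (Yt * Xt)%type R).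
Variables (f : Yt -> Xt -> R) (nu : {measure set Xt -> \bar R}) (g : Xt -> R).
Hypothesis Ff : has_density Y X F f nu g.
Variables (h : R) (m : nat) (A : 'I_m.+1 -> set Yt) (mu : 'I_m -> Yt).
Hypothesis h0 : 0 < h.
Hypothesis YA : cubic_partition Y h A mu.
Variables (sigma sigma0 : R).
Hypothesis sigma_gt0 : 0 < sigma.
Hypothesis sigma0_gt0 : 0 < sigma0.
Variables (x : Xt).
Hypothesis Xx : X x.
Hypothesis A_gt0 : forall j, 0 < cond_prob f (A j) x.

Let mY : measurable Y := has_density_measurableY Ff.

(** A cell contained in Q, where the density is at least v, has probability at
    least v h^d. *)
Lemma model0_ge_cells (Q S : set Yt) (y : Yt) (v t eta : R) :
  0 <= t -> h <= eta * sigma -> measurable S -> S `<=` box y (t * sigma) ->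
  (forall z, S z -> exists2 j, A (lift ord0 j) `<=` Q & A (lift ord0 j) z) ->
  0 <= v -> (forall z, Q z -> v <= f z x) ->
  ((v * expR (- (d%:R * (eta * t + eta ^+ 2 / 4) / 2)))%:E *
    \int[lebesgue_rV]_(z in S) (normal_density y z sigma)%:E <=
   (model0 f A mu sigma sigma0 y x)%:E)%E.
Proof.
move=> t0 heta mS Sbox SQ v0 vf.
apply: (@mixture_ge_cells _ _ _ (fun j => A (lift ord0 j)) _ h _ _ _ _
  [pred j | `[< A (lift ord0 j) `<=` Q >]]) => //.
- exact: ltW.
- by move=> j; exact: measurable_cell YA j.
- by move=> j; exact: lebesgue_cell h0 YA j.
- by move=> j z i Bz; exact: (@cell_dist _ _ _ _ _ _ _ YA j z i Bz).
- by move=> z Sz; have [j jQ Ajz] := SQ z Sz; exists j => //; apply/asboolP.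
- by move=> j; rewrite ltW.
- move=> j /asboolP jQ.
  apply: (cond_prob_ge Ff (B := A (lift ord0 j))) => //.
  + exact: measurable_cell YA j.
  + exact: cell_sub YA _.
  + exact: measurable_cell YA j.
  + exact: lebesgue_cell h0 YA j.
  + by move=> z /jQ /vf.
Qed.

(** A lower bound for the share of the Gaussian mass carried by the cells
    inside an orthant: the discretization factor of [model0_ge_cells] for
    eta = 1/4 and t = 2, times the least value of the density on the box of
    half side 2 sigma multiplied by the volume sigma^d of a cube in this box. *)
Definition orthant_mass : R :=
  expR (- (d%:R * (4^-1 * 2 + 4^-1 ^+ 2 / 4) / 2)) *
  (Num.sqrt (2 * pi) ^- d * expR (- (d%:R * 2 ^+ 2 / 2))).

Lemma orthant_mass_gt0 : 0 < orthant_mass.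
Proof.
rewrite !mulr_gt0 ?expR_gt0// invr_gt0 exprn_gt0// sqrtr_gt0 mulr_gt0//.
exact: pi_gt0.
Qed.

(** C_1 has a vertex at y and side r / 2.  The cube S of side sigma, centered
    at distance sigma from y in each coordinate in the direction of the center
    c of C_1, lies in C_1 with a margin of at least h, so each cell that meets
    S is contained in C_1. *)
Lemma model0_ge_orthant (r : R) (y : Yt) (C1 : set Yt) (v : R) :
  h <= 4^-1 * sigma -> sigma <= r / 4 ->
  is_hypercube_with_vertex y (r / 2) C1 -> C1 `<=` Y `\` A ord0 ->
  0 <= v -> (forall z, C1 z -> v <= f z x) ->
  v * orthant_mass <= model0 f A mu sigma sigma0 y x.
Proof.
move=> hs sr [l [r' [c [C1E yc]]]] C1Y v0 vf.
(* The direction of C_1 from y along the i-th axis. *)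
pose sg i : R := if y 0 i <= c 0 i then 1 else -1.
have sgE i : c 0 i - y 0 i = sg i * (r / 4).
  have := yc i; rewrite /sg; case: ifPn => [le|]; last rewrite -ltNge => lt.
    by rewrite distrC ger0_norm ?subr_ge0// => ->; field.
  by rewrite gtr0_norm ?subr_gt0// => yce; rewrite -opprB yce; field.
have sg2 i (a : R) : `|sg i * a| = `|a|.
  by rewrite /sg; case: ifP => _; rewrite ?mul1r ?mulN1r ?normrN.
pose w : Yt := \row_i (y 0 i + sg i * sigma).
pose S := closed_cube w sigma.
have mS : measurable S by exact: measurable_cube.
have Sw z i : S z -> `|z 0 i - y 0 i - sg i * sigma| <= sigma / 2.
  by move=> /(cube_dist i); rewrite mxE opprD addrA.
have Sbox : S `<=` box y (2 * sigma).
  move=> z Sz i; have := Sw z i Sz => zw.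
  rewrite (_ : z 0 i - y 0 i = (z 0 i - y 0 i - sg i * sigma) + sg i * sigma);
    last by ring.
  apply: le_trans (ler_normD _ _) _; rewrite sg2 (gtr0_norm sigma_gt0).
  apply: le_trans (lerD zw (lexx sigma)) _; have := sigma_gt0; lra.
have C1in (z : Yt) :
    (forall i, `|z 0 i - y 0 i - sg i * sigma| <= sigma / 2 + h) -> C1 z.
  move=> zy; rewrite C1E => i.
  have : `|z 0 i - c 0 i| < r / 2 / 2.
    have -> : z 0 i - c 0 i = (z 0 i - y 0 i - sg i * sigma) +
       sg i * (sigma - r / 4).
      by rewrite mulrBr -sgE; ring.
    apply: le_lt_trans (ler_normD _ _) _; rewrite sg2.
    rewrite (ler0_norm (x := sigma - _)) ?subr_le0//.
    apply: le_lt_trans (lerD (zy i) (lexx _)) _.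
    by have := h0; have := sigma_gt0; lra.
  rewrite ltr_distl in_itv/= => /andP[zl zr].
  by case: (l i) => /=; case: (r' i) => /=; rewrite ?(ltW zl) ?(ltW zr) ?zl ?zr.
have SQ z : S z -> exists2 j, A (lift ord0 j) `<=` C1 & A (lift ord0 j) z.
  move=> Sz; have C1z : C1 z.
    by apply: C1in => i; rewrite (le_trans (Sw z i Sz))// lerDl ltW.
  have [Yz nA0z] := C1Y z C1z.
  have [j Ajz] := cell_cover YA Yz nA0z; exists j => // z' Ajz'.
  apply: C1in => i.
  have zj := cell_dist YA i Ajz; have zj' := cell_dist YA i Ajz'.
  rewrite (_ : z' 0 i - y 0 i - sg i * sigma = (z' 0 i - mu j 0 i) +
    (mu j 0 i - z 0 i) + (z 0 i - y 0 i - sg i * sigma)); last by ring.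
  apply: le_trans (ler_normD _ _) _; rewrite addrC lerD ?Sw//.
  apply: le_trans (ler_normD _ _) _; rewrite [leRHS](splitr h) lerD//.
  by rewrite distrC.
have t0 : (0 : R) <= 2 by [].
have := model0_ge_cells t0 hs mS Sbox SQ v0 vf.
rewrite -lee_fin; apply: le_trans; rewrite /orthant_mass mulrA EFinM.
rewrite lee_wpmul2l ?lee_fin ?mulr_ge0 ?expR_ge0//.
set K := _ * expR _.
pose k := Num.sqrt (2 * pi * sigma ^+ 2) ^- d *
  expR (- (d%:R * 2 ^+ 2 / 2)).
have KE : K = k * sigma ^+ d.
  rewrite /K /k (@sqrtrM _ (2 * pi) (sigma ^+ 2)) ?mulr_ge0 ?pi_ge0//.
  rewrite sqrtr_sqr gtr0_norm// exprMn invfM.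
  by rewrite [RHS]mulrAC divfK// expf_neq0// gt_eqF.
rewrite KE EFinM -(lebesgue_rV_cube (fun=> true) (fun=> false) w sigma_gt0).
rewrite -integral_cst//; apply: ge0_le_integral => //.
- by move=> z _; rewrite lee_fin mulr_ge0 ?expR_ge0// invr_ge0 exprn_ge0.
- apply: measurable_funTS; under eq_fun do rewrite normal_densityC.
  by apply/measurable_EFinP; exact: measurable_normal_density.
- by move=> z Sz; rewrite lee_fin normal_density_box_ge//; exact: Sbox.
Qed.

(** The component centered at 0 has weight F(A_0|x), at least v times the
    volume of C_0. *)
Lemma model0_ge_rest (r : R) (y : Yt) (C0 : set Yt) (v : R) : 0 < r ->
  is_hypercube_with_vertex y (r / 2) C0 -> C0 `<=` A ord0 ->
  0 <= v -> (forall z, C0 z -> v <= f z x) ->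
  v * ((r / 2) ^+ d * normal_density y 0 sigma0) <=
    model0 f A mu sigma sigma0 y x.
Proof.
move=> r0 [l [r' [c [C0E yc]]]] C0A v0 vf.
have nd0 (u a : Yt) t : 0 < t -> 0 <= normal_density u a t.
  by move=> t0; rewrite ltW// normal_density_gt0.
rewrite /model0 /mixture mulrA -[leLHS]add0r lerD//.
  by apply: sumr_ge0 => j _; rewrite mulr_ge0 ?nd0// ltW.
rewrite ler_wpM2r ?nd0//.
apply: (cond_prob_ge Ff (B := C0)) => //.
- exact: measurable_rest YA.
- exact: cell_sub YA _.
- by rewrite C0E; exact: measurable_cube.
- by rewrite C0E lebesgue_rV_cube// divr_gt0.
Qed.

(** The cells that meet the box of half side t sigma around y are contained in
    the box of half side delta / 2, which lies in Y and avoids A_0; the small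
    box carries at least a fraction q of the Gaussian mass, by the choice of
    t. *)
Lemma model0_ge_center (delta e : R) (y : Yt) (v t eta q : R) :
  0 <= t -> h <= eta * sigma -> t * sigma + h <= delta / 2 ->
  (forall z : Yt, (forall i, `|z 0 i - y 0 i| <= delta / 2) -> Y z) ->
  closed_cube y delta `&` A ord0 = set0 ->
  0 <= v -> (forall z, box y (delta / 2) z -> v <= f z x) ->
  d%:R * (eta * t + eta ^+ 2 / 4) / 2 <= e ->
  Num.sqrt 2 ^+ d * expR (- (t ^+ 2 / 4)) <= 1 - q -> 
  0 <= q ->
  v * expR (- e) * q <= model0 f A mu sigma sigma0 y x.
Proof.
move=> t0 heta th Yin nA0 v0 vf ke tq q0.
pose S := box y (t * sigma).
have mS : measurable S by exact: measurable_box.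
have Sd z : S z -> forall i, `|z 0 i - y 0 i| <= delta / 2.
  by move=> Sz i; rewrite (le_trans (Sz i))// (le_trans _ th)// lerDl ltW.
have SQ z : S z -> exists2 j, A (lift ord0 j) `<=` box y (delta / 2) &
    A (lift ord0 j) z.
  move=> Sz; have zd := Sd z Sz.
  have nA0z : ~ A ord0 z.
    move=> A0z; suff : (closed_cube y delta `&` A ord0) z by rewrite nA0.
    by split => // i; rewrite in_itv/= -ler_distl.
  have [j Ajz] := cell_cover YA (Yin z zd) nA0z; exists j => // z' Ajz' i.
  apply: le_trans th.
  have zj := cell_dist YA i Ajz; have zj' := cell_dist YA i Ajz'.
  rewrite (_ : z' 0 i - y 0 i = (z' 0 i - mu j 0 i) +
    (mu j 0 i - z 0 i) + (z 0 i - y 0 i)); last by ring.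
  apply: le_trans (ler_normD _ _) _; rewrite addrC lerD ?Sz//.
  apply: le_trans (ler_normD _ _) _; rewrite [leRHS](splitr h) lerD//.
  by rewrite distrC.
have := model0_ge_cells t0 heta mS (@subset_refl _ S) SQ v0 vf.
rewrite -lee_fin; apply: le_trans; rewrite EFinM.
apply: (@le_trans _ _
  ((v * expR (- (d%:R * (eta * t + eta ^+ 2 / 4) / 2)))%:E * q%:E)%E).
  rewrite lee_wpmul2r ?lee_fin//; rewrite ler_wpM2l// ler_expR lerN2//.
rewrite lee_wpmul2l ?lee_fin ?mulr_ge0 ?expR_ge0//.
apply: le_trans (integral_normal_density_box y sigma_gt0 t0).
by rewrite lee_fin; lra.
Qed.

End model0_lower_bounds.

(** * Pointwise limit of the mixture *)

(** When v = 0 the right-hand side is +oo, because a is positive. *)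
Lemma pos_log_ratio_le (R : realType) (a v k p K : R) :
  0 < a -> 0 <= v -> v <= a -> 0 < k -> 0 < p -> v * k <= p ->
  - ln k <= K -> 0 <= K ->
  ((Num.max (ln a - ln p) 0)%:E <= log_ratio a v + K%:E)%E.
Proof.
move=> a0 v0 va k0 p0 vkp lnk K0.
have [->|vn0] := eqVneq v 0; first by rewrite log_ratio0r// addye ?leey.
have {v0 vn0}v0 : 0 < v by rewrite lt_neqAle eq_sym vn0.
rewrite log_ratio_pos// -EFinD lee_fin ge_max.
have lnv : ln v <= ln a by rewrite ler_ln.
have : ln (v * k) <= ln p by rewrite ler_ln// posrE mulr_gt0.
by rewrite lnM// => lnp; apply/andP; split; lra.
Qed.

Lemma within_cvg_gt (R : realType) d (Y : set 'rV[R]_d) (u : 'rV[R]_d -> R)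
    (y : 'rV[R]_d) (l v : R) :
  u z @[z --> within Y (nbhs y)] --> l -> v < l ->
  exists2 e : R, 0 < e & forall z : 'rV[R]_d, Y z ->
    (forall i, `|z 0 i - y 0 i| < e) -> v < u z.
Proof.
move=> ul vl; have H := cvgr_gt _ ul _ vl.
have /nbhs_ballP[e /= e0 He] : nbhs y (fun z => Y z -> v < u z) by exact: H.
exists e => // z Yz zy; apply: He => //; split => // i j.
by rewrite (ord1 i) /ball/= distrC; exact: zy.
Qed.

(** delta^(d-1) h / sigma^d = (delta / sigma)^(d-1) (h / sigma), and the first
    factor is eventually at least 1. *)
Lemma mesh_over_bandwidth (R : realType) d (h delta sigma : nat -> R) :
  (0 < d)%N -> (forall m, 0 < h m) -> (forall m, 0 < delta m) ->
  (forall m, 0 < sigma m) ->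
  (fun m => sigma m / delta m) @ \oo --> (0 : R) ->
  (fun m => delta m ^+ d.-1 * h m / sigma m ^+ d) @ \oo --> (0 : R) ->
  forall eta, 0 < eta -> \forall m \near \oo, h m <= eta * sigma m.
Proof.
move=> d0 h0 delta0 sigma0 sd dh eta eta0.
have sd1 := cvgr_lt _ sd _ ltr01.
have dh1 := cvgr_lt _ dh _ eta0.
near=> m.
have s1 : sigma m / delta m < 1 by near: m; exact: sd1.
have : delta m ^+ d.-1 * h m / sigma m ^+ d < eta by near: m; exact: dh1.
have s0 := sigma0 m; have hm := h0 m.
have sdm : sigma m <= delta m by rewrite -[leRHS]mul1r -ler_pdivrMr// ltW.
rewrite ltr_pdivrMr ?exprn_gt0// -{2}(prednK d0) exprSr mulrA => H.
rewrite -(ler_pM2l (x := sigma m ^+ d.-1)) ?exprn_gt0//.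
apply: le_trans (_ : delta m ^+ d.-1 * h m <= _).
  by rewrite ler_wpM2r ?(ltW hm)// lerXn2r ?nnegrE ?(ltW s0)// (ltW (delta0 m)).
by rewrite mulrCA mulrA ltW.
Unshelve. all: by end_near. Qed.

(** With l the logarithm of the desired ratio, t = 2 (1 + |l|) gives
    t^2 / 4 >= - l. *)
Lemma small_normal_tail (R : realType) d (q : R) : q < 1 ->
  exists2 t : R, 0 <= t &
  Num.sqrt 2 ^+ d * expR (- (t ^+ 2 / 4)) <= 1 - q.
Proof.
move=> q1; have s2 : 0 < Num.sqrt (2 : R) ^+ d by rewrite exprn_gt0// sqrtr_gt0.
have q2 : 0 < (1 - q) / Num.sqrt 2 ^+ d by rewrite divr_gt0// subr_gt0.
pose l := ln ((1 - q) / Num.sqrt 2 ^+ d).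
exists (2 * (1 + `|l|)); first by rewrite mulr_ge0// addr_ge0.
rewrite mulrC -ler_pdivlMr// -[leRHS]lnK ?posrE// ler_expR -/l.
have := ler_norm (- l); rewrite normrN; have := normr_ge0 l.
by move: `|l| => a a0 la; nra.
Qed.

Lemma small_discretization (R : realType) d (t e : R) : 0 <= t -> 0 < e ->
  exists2 eta : R, 0 < eta & d%:R * (eta * t + eta ^+ 2 / 4) / 2 <= e.
Proof.
move=> t0 e0; pose D : R := d%:R.
have D0 : 0 <= D by rewrite ler0n.
pose eta := Num.min 1 (2 * e / ((D + 1) * (t + 1))).
have den : 0 < (D + 1) * (t + 1) by rewrite mulr_gt0// ltr_wpDl.
have eta0 : 0 < eta by rewrite lt_min ltr01/= divr_gt0// mulr_gt0.
exists eta => //; rewrite -/D.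
have eta1 : eta <= 1 by rewrite ge_min lexx.
have eta2 : eta * ((D + 1) * (t + 1)) <= 2 * e.
  by rewrite -ler_pdivlMr// ge_min lexx orbT.
have : eta * t + eta ^+ 2 / 4 <= eta * (t + 1) by nra.
have : 0 <= eta * (t + 1) by rewrite mulr_ge0 ?addr_ge0 ?(ltW eta0).
by nra.
Qed.

(** The loss exp(- e) is shared equally between the three sources of error:
    the oscillation of f near y, the replacement of an integral by a Riemann
    sum, and the Gaussian tail outside of the box. *)
Lemma model0_lower_limit (R : realType) (d dx : nat) (Y : set 'rV[R]_d)
  (X : set 'rV[R]_dx) (F : probability ('rV[R]_d * 'rV[R]_dx)%type R)
  (f : 'rV[R]_d -> 'rV[R]_dx -> R) (nu : {measure set 'rV[R]_dx -> \bar R})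
  (g : 'rV[R]_dx -> R) (h delta sigma : nat -> R) (sigma0 : R)
  (A : forall m, 'I_m.+1 -> set 'rV[R]_d) (mu : forall m, 'I_m -> 'rV[R]_d)
  (y : 'rV[R]_d) (x : 'rV[R]_dx) :
  has_density Y X F f nu g ->
  (forall m, 0 < h m) -> (forall m, 0 < delta m) ->
  (forall m, 0 < sigma m) -> 0 < sigma0 ->
  (forall m, cubic_partition Y (h m) (A m) (mu m)) ->
  (exists M0, forall m, (M0 <= m)%N ->
     closed_cube y (delta m) `&` A m ord0 = set0) ->
  delta @ \oo --> (0 : R) ->
  (fun m => sigma m / delta m) @ \oo --> (0 : R) ->
  (forall eta, 0 < eta -> \forall m \near \oo, h m <= eta * sigma m) ->
  X x -> (forall m j, 0 < cond_prob f (A m j) x) -> 0 < f y x ->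
  (exists2 e : R, 0 < e &
    forall z : 'rV[R]_d, (forall i, `|z 0 i - y 0 i| < e) -> Y z) ->
  f z x @[z --> within Y (nbhs y)] --> f y x ->
  forall e, 0 < e -> \forall m \near \oo,
    f y x * expR (- e) <= model0 f (A m) (mu m) (sigma m) sigma0 y x.
Proof.
move=> Ff h0 delta0 s0 sigma00 YA [M0 nA0] dcvg sdcvg hs Xx cp0 fy [e0 e00 Yin]
  fc e e_gt0.
pose e3 := e / 3; have e30 : 0 < e3 by rewrite divr_gt0.
pose q := expR (- e3); have q0 : 0 < q by rewrite expR_gt0.
have q1 : q < 1 by rewrite -expR0 ltr_expR oppr_lt0.
have vf : f y x * q < f y x by rewrite -[ltRHS]mulr1 ltr_pM2l.
have [e1 e10 fv] := within_cvg_gt fc vf.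
have [t t0 tq] := small_normal_tail d q1.
have [eta eta0 etae] := small_discretization d t0 e30.
have te0 : 0 < 2 * (t + eta) by rewrite mulr_gt0// ltr_wpDl.
have H1 := hs eta eta0.
have tei : 0 < (2 * (t + eta))^-1 by rewrite invr_gt0.
have H2 := cvgr_lt _ sdcvg _ tei.
have H3 := cvgr_lt _ dcvg _ e00.
have H4 := cvgr_lt _ dcvg _ e10.
near=> m.
have hm : h m <= eta * sigma m by near: m; exact: H1.
have sd : sigma m / delta m < (2 * (t + eta))^-1 by near: m; exact: H2.
have d0 : delta m < e0 by near: m; exact: H3.
have d1 : delta m < e1 by near: m; exact: H4.
have mM : (M0 <= m)%N by near: m; exact: nbhs_infty_ge.
have dm := delta0 m; have sm := s0 m.
have th : t * sigma m + h m <= delta m / 2.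
  apply: le_trans (lerD (lexx _) hm) _; rewrite -mulrDl.
  move: sd; rewrite ltr_pdivrMr// ltr_pdivlMl// => /ltW.
  by rewrite ler_pdivlMr// [_ * 2]mulrC mulrA.
have d2 : delta m / 2 <= delta m by rewrite ler_pdivrMr// ler_pMr// ler1n.
have := @model0_ge_center _ _ _ _ _ _ _ _ _ Ff _ _ _ _ (h0 m) (YA m) _ _ sm
  sigma00 _ Xx (cp0 m) (delta m) e3 y (f y x * q) t eta q t0 hm th.
have -> : f y x * expR (- e) = f y x * q * expR (- e3) * q.
  rewrite /q -!mulrA -!expRD; congr (_ * expR _).
  by rewrite /e3; field.
apply => //.
- by move=> z zy; apply: Yin => i; rewrite (le_lt_trans (zy i))// (le_lt_trans d2).
- exact: nA0.
- by rewrite mulr_ge0 ?ltW.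
- move=> z zy; apply/ltW/fv.
    by apply: Yin => i; rewrite (le_lt_trans (zy i))// (le_lt_trans d2).
  by move=> i; rewrite (le_lt_trans (zy i))// (le_lt_trans d2).
- exact: ltW.
Unshelve. all: by end_near. Qed.

(** * Domination and convergence of the divergences *)

(** The lower bounds of the mixture in the two cases, y in A_0 and y in a cell,
    have the form v k with v the infimum of f over C; - ln k is a constant in
    one case and, up to a constant, |y|^2 / (2 sigma0^2) in the other. *)
Lemma log_ratio_domination (R : realType) (d dx : nat) (Y : set 'rV[R]_d)
  (X : set 'rV[R]_dx) (F : probability ('rV[R]_d * 'rV[R]_dx)%type R)
  (f : 'rV[R]_d -> 'rV[R]_dx -> R) (nu : {measure set 'rV[R]_dx -> \bar R})
  (g : 'rV[R]_dx -> R) (h sigma sigma0 r : R) (m : nat)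
  (A : 'I_m.+1 -> set 'rV[R]_d) (mu : 'I_m -> 'rV[R]_d)
  (y : 'rV[R]_d) (x : 'rV[R]_dx) (C C0 C1 : set 'rV[R]_d) :
  has_density Y X F f nu g -> 0 < h -> 0 < sigma -> 0 < sigma0 -> 0 < r ->
  cubic_partition Y h A mu -> Y y -> X x ->
  (forall j, 0 < cond_prob f (A j) x) -> 0 < f y x ->
  h <= 4^-1 * sigma -> sigma <= r / 4 -> C y ->
  (A ord0 y -> is_hypercube_with_vertex y (r / 2) C0 /\
     C0 `<=` C `&` A ord0) ->
  ((Y `\` A ord0) y -> is_hypercube_with_vertex y (r / 2) C1 /\
     C1 `<=` C `&` (Y `\` A ord0)) ->
  ((Num.max (ln (f y x) - ln (model0 f A mu sigma sigma0 y x)) 0)%:E <=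
   log_ratio (f y x) (inf [set f z x | z in C]) +
   (`|ln (orthant_mass R d)| +
    `|ln ((r / 2) ^+ d * Num.sqrt (2 * pi * sigma0 ^+ 2) ^- d)| +
    (\sum_(i < d) y 0 i * y 0 i) / (2 * sigma0 ^+ 2))%:E)%E.
Proof.
move=> Ff h0 s0 s00 r0 YA Yy Xx cp0 fy hs sr Cy HC0 HC1.
set v := inf _; set a := `|ln (orthant_mass R d)|; set b := `|ln (_ * _)|.
set S := \sum_(i < d) _.
have f0 z w : 0 <= f z w := has_density_cond_ge0 Ff z w.
have v0 : 0 <= v.
  by apply: lb_le_inf; [exists (f y x); exists y|move=> _ [z _ <-]].
have vC z : C z -> v <= f z x.
  by move=> Cz; apply: ge_inf; [exists 0 => _ [w _ <-]|exists z].
have p0 : 0 < model0 f A mu sigma sigma0 y x by exact: mixture_gt0.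
have a0 : 0 <= a by rewrite normr_ge0.
have b0 : 0 <= b by rewrite normr_ge0.
have ss0 : 0 < 2 * sigma0 ^+ 2 by rewrite mulr_gt0// exprn_gt0.
have S0 : 0 <= S / (2 * sigma0 ^+ 2).
  rewrite divr_ge0 ?(ltW ss0)//.
  by apply: sumr_ge0 => i _; rewrite -expr2 sqr_ge0.
have K0 : 0 <= a + b + S / (2 * sigma0 ^+ 2) by rewrite !addr_ge0.
have [A0y|nA0y] := pselect (A ord0 y).
  have [C0v C0C] := HC0 A0y.
  have pk := model0_ge_rest Ff YA s0 s00 Xx cp0 (y := y) (v := v) r0 C0v
    (fun z C0z => (C0C z C0z).2) v0 (fun z C0z => vC z (C0C z C0z).1).
  have c2 : 0 < (r / 2) ^+ d * Num.sqrt (2 * pi * sigma0 ^+ 2) ^- d.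
    rewrite mulr_gt0 ?exprn_gt0 ?divr_gt0// invr_gt0 exprn_gt0// sqrtr_gt0.
    by rewrite !mulr_gt0 ?pi_gt0 ?exprn_gt0.
  apply: (pos_log_ratio_le fy v0 (vC y Cy) _ p0 pk) => //.
    by rewrite mulr_gt0 ?normal_density_gt0 ?exprn_gt0 ?divr_gt0.
  rewrite /normal_density mulrA lnM ?posrE ?expR_gt0// expRK.
  rewrite (_ : \sum_(i < d) _ = S); last first.
    by apply: eq_bigr => i _; rewrite mxE subr0 expr2.
  have : - b <= ln ((r / 2) ^+ d * Num.sqrt (2 * pi * sigma0 ^+ 2) ^- d).
    by rewrite lerNl /b -normrN ler_norm.
  by rewrite mulNr; lra.
have [C1v C1C] := HC1 (conj Yy nA0y).
have pk := model0_ge_orthant Ff h0 YA s0 s00 Xx cp0 hs sr C1v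
  (fun z C1z => (C1C z C1z).2) v0 (fun z C1z => vC z (C1C z C1z).1).
apply: (pos_log_ratio_le fy v0 (vC y Cy) _ p0 pk) => //.
  exact: orthant_mass_gt0.
have : - a <= ln (orthant_mass R d) by rewrite lerNl /a -normrN ler_norm.
by lra.
Qed.

Theorem corollary3p1 (R : realType) (d dx : nat) (d_gt0 : (0 < d)%N)
  (Y : set 'rV[R]_d) (X : set 'rV[R]_dx)
  (F : probability ('rV[R]_d * 'rV[R]_dx)%type R)
  (f : 'rV[R]_d -> 'rV[R]_dx -> R)
  (nu : {measure set 'rV[R]_dx -> \bar R}) (g : 'rV[R]_dx -> R)
  (F_density : has_density Y X F f nu g)
  (h delta sigma : nat -> R) (sigma0 : R)
  (h_gt0 : forall m, 0 < h m) (delta_gt0 : forall m, 0 < delta m)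
  (sigma_gt0 : forall m, 0 < sigma m) (sigma0_gt0 : 0 < sigma0)
  (A : forall m, 'I_m.+1 -> set 'rV[R]_d) (mu : forall m, 'I_m -> 'rV[R]_d)
  (A_partition : forall m, cubic_partition Y (h m) (A m) (mu m))
  (* (a) *)
  (h_cvg0 : h @ \oo --> (0 : R))
  (fine_partition : forall y, Y y -> exists M0, forall m, (M0 <= m)%N ->
     closed_cube y (delta m) `&` A m ord0 = set0)
  (* (b) *)
  (delta_cvg0 : delta @ \oo --> (0 : R))
  (sigma_delta_cvg0 : (fun m => sigma m / delta m) @ \oo --> (0 : R))
  (delta_h_sigma_cvg0 :
     (fun m => delta m ^+ d.-1 * h m / sigma m ^+ d) @ \oo --> (0 : R))
  (* (c) *)
  (f_continuous : {ae F, forall z, (Y `*` X) z ->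
     f y z.2 @[y --> within Y (nbhs z.1)] --> f z.1 z.2})
  (* (d) *)
  (second_moments : forall i j : 'I_d, F.-integrable (Y `*` X)
     (fun z : 'rV[R]_d * 'rV[R]_dx => (z.1 0 i * z.1 0 j)%:E))
  (* (e) *)
  (r : R) (r_gt0 : 0 < r)
  (C : 'rV[R]_d -> 'rV[R]_dx -> set 'rV[R]_d)
  (C_hypercube : forall y x, Y y -> X x -> is_hypercube r (C y x) /\ C y x y)
  (log_ratio_inf_integrable : F.-integrable (Y `*` X)
     (fun z : 'rV[R]_d * 'rV[R]_dx => log_ratio (f z.1 z.2)
        (inf [set f y z.2 | y in C z.1 z.2])))
  (M3 : nat) (C0 C1 : nat -> 'rV[R]_d -> 'rV[R]_dx -> set 'rV[R]_d)
  (C0_hypercube : forall m y x, (M3 <= m)%N -> X x -> A m ord0 y ->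
     is_hypercube_with_vertex y (r / 2) (C0 m y x) /\
     C0 m y x `<=` C y x `&` A m ord0)
  (C1_hypercube : forall m y x, (M3 <= m)%N -> X x -> (Y `\` A m ord0) y ->
     is_hypercube_with_vertex y (r / 2) (C1 m y x) /\
     C1 m y x `<=` C y x `&` (Y `\` A m ord0))
  (* (f) *)
  (C0_bound : forall m y x, (M3 <= m)%N -> X x -> A m ord0 y ->
     ((normal_density y 0 sigma0)%:E * lebesgue_rV (C0 m y x)
        < ((2 : R) ^- d.+1)%R%:E < 1)%E)
  (* (g) *)
  (X_compact : compact X)
  (cond_prob_continuous : forall m j,
     {within X, continuous (cond_prob f (A m j))})
  (cond_prob_gt0 : forall m j x, X x -> 0 < cond_prob f (A m j) x)
  (eps : nat -> R) (eps_gt0 : forall m, 0 < eps m)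
  (eps_cvg0 : eps @ \oo --> (0 : R))
  (P : forall m, 'I_m.+1 -> mpoly.mpoly dx R)
  (P_approx : forall m j x, X x ->
     `|ln (cond_prob f (A m j) x) - poly_eval (P m j) x| < eps m) :
  let KL0 m := dKL Y X F f (model0 f (A m) (mu m) (sigma m) sigma0) in
  let KL1 m := dKL Y X F f (model1 (P m) (mu m) (sigma m) sigma0) in
  (forall m, KL0 m - (2 * eps m)%R%:E <= KL1 m /\
             KL1 m <= KL0 m + (2 * eps m)%R%:E)%E /\
  KL1 m @[m --> \oo] --> 0%E.

Proof.
have mY := has_density_measurableY F_density.
have mX := has_density_measurableX F_density.
have mYX : measurable (Y `*` X) by exact: measurableX.
move=> KL0 KL1.
have sum1 m x : X x -> \sum_j cond_prob f (A m j) x = 1.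
  move=> Xx; apply: (cond_prob_sum1 F_density) => //;
    last by case: (A_partition m).
  exact: measurable_part mY (A_partition m).
pose p0 m := model0 f (A m) (mu m) (sigma m) sigma0.
pose p1 m := model1 (P m) (mu m) (sigma m) sigma0.
have p0_gt0 m y x : X x -> 0 < p0 m y x.
  by move=> Xx; apply: mixture_gt0 => // j; exact: cond_prob_gt0.
have p1_gt0 m y x : X x -> 0 < p1 m y x.
  by move=> _; apply: mixture_gt0 => // j; exact: softmax_weight_gt0.
have mp0 m : measurable_fun (Y `*` X)
    (fun z : 'rV[R]_d * 'rV[R]_dx => p0 m z.1 z.2).
  apply: (measurable_mixture (w := fun j => cond_prob f (A m j))) => // j.
  apply: (measurable_cond_prob F_density).
    exact: measurable_part mY (A_partition m) j.
  exact: cell_sub (A_partition m) j.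
have mp1 m : measurable_fun (Y `*` X)
    (fun z : 'rV[R]_d * 'rV[R]_dx => p1 m z.1 z.2).
  apply: (measurable_mixture (w := fun j x => softmax_weight (P m) x j)) => // j.
  by apply: measurable_funTS; exact: measurable_softmax_weight.
have p01 m y x : X x -> `|ln (p0 m y x) - ln (p1 m y x)| <= 2 * eps m.
  move=> Xx; have close := softmax_weight_close (fun j => cond_prob_gt0 m j x Xx)
    (sum1 m x Xx) (fun j => P_approx m j x Xx).
  have le01 : p0 m y x <= expR (2 * eps m) * p1 m y x.
    by apply: mixture_scale => // j; have [] := close j.
  have le10 : p1 m y x <= expR (2 * eps m) * p0 m y x.
    by apply: mixture_scale => // j; have [] := close j.
  move: le01 le10; rewrite -ler_ln ?posrE ?mulr_gt0 ?expR_gt0 ?p0_gt0 ?p1_gt0//.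
  rewrite lnM ?posrE ?expR_gt0 ?p1_gt0// expRK => le01.
  rewrite -ler_ln ?posrE ?mulr_gt0 ?expR_gt0 ?p0_gt0 ?p1_gt0//.
  rewrite lnM ?posrE ?expR_gt0 ?p0_gt0// expRK => le10.
  by rewrite ler_distl; apply/andP; split; lra.
have eps2 m : 0 <= 2 * eps m by rewrite mulr_ge0// ltW.
have sandwich m : (KL0 m - (2 * eps m)%R%:E <= KL1 m /\
             KL1 m <= KL0 m + (2 * eps m)%R%:E)%E.
  split.
    rewrite leeBlDr//.
    exact: (dKL_shift F_density (mp0 m) (mp1 m) (p0_gt0 m) (p1_gt0 m) (eps2 m)
      (p01 m)).
  apply: (dKL_shift F_density (mp1 m) (mp0 m) (p1_gt0 m) (p0_gt0 m) (eps2 m)).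
  by move=> y x Xx; rewrite distrC; exact: p01.
split => //.
(* It remains to show that the divergences of M_0 tend to 0. *)
pose pos m (z : 'rV[R]_d * 'rV[R]_dx) : \bar R :=
  (Num.max (ln (f z.1 z.2) - ln (p0 m z.1 z.2)) 0)%:E.
have pos0 m z : (0 <= pos m z)%E by rewrite lee_fin le_max lexx orbT.
have mpos m : measurable_fun (Y `*` X) (pos m).
  have := measurable_funepos (measurable_log_difference F_density (mp0 m)).
  by apply: eq_measurable_fun => z _; rewrite funepos.unlock /pos EFin_max.
have hs := mesh_over_bandwidth d_gt0 h_gt0 delta_gt0 sigma_gt0 sigma_delta_cvg0
  delta_h_sigma_cvg0.
pose K0 := `|ln (orthant_mass R d)| +
    `|ln ((r / 2) ^+ d * Num.sqrt (2 * pi * sigma0 ^+ 2) ^- d)|.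
pose D (z : 'rV[R]_d * 'rV[R]_dx) : \bar R :=
  (log_ratio (f z.1 z.2) (inf [set f y z.2 | y in C z.1 z.2]) +
   (K0 + (\sum_(i < d) z.1 0 i * z.1 0 i) / (2 * sigma0 ^+ 2))%:E)%E.
have iD : F.-integrable (Y `*` X) D.
  have iK : F.-integrable (Y `*` X)
      (fun z : 'rV[R]_d * 'rV[R]_dx => (K0%:E +
        (2 * sigma0 ^+ 2)^-1%:E * \sum_(i < d) (z.1 0 i * z.1 0 i)%:E)%E).
    apply: integrableD => //; first exact: finite_measure_integrable_cst.
    apply: integrableZl => //; apply: (integrable_sum mYX) => i _.
    exact: second_moments.
  apply: integrableD => //; apply: eq_integrable iK => // z _.
  by rewrite sumEFin -EFinM -EFinD mulrC.
have fpos := ae_density_gt0 F_density.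
have s41 : (0 : R) < 4^-1 by [].
have r4 : 0 < r / 4 by rewrite divr_gt0.
(* The domination holds from a rank N on, so the dominated convergence theorem
   is applied to the sequence shifted by N. *)
have [N [NM3 Nh Ns]] : exists N, [/\ (M3 <= N)%N,
    forall m, (N <= m)%N -> h m <= 4^-1 * sigma m &
    forall m, (N <= m)%N -> sigma m <= r / 4].
  have [N1 _ H1] := hs _ s41.
  have [N2 _ H2] := cvgr_lt _ sigma_delta_cvg0 _ ltr01.
  have [N3 _ H3] := cvgr_lt _ delta_cvg0 _ r4.
  exists (maxn M3 (maxn N1 (maxn N2 N3))); split; first exact: leq_maxl.
    move=> m; rewrite !geq_max => /and4P[_ mN1 _ _]; exact: H1.
  move=> m; rewrite !geq_max => /and4P[_ _ mN2 mN3].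
  have := H2 m mN2; have := H3 m mN3 => /= dr.
  by rewrite ltr_pdivrMr// mul1r => sd; rewrite ltW// (lt_trans sd).
have dom : {ae F, forall z m, (Y `*` X) z -> (`|pos (m + N)%N z| <= D z)%E}.
  apply: filterS fpos => -[y x] fz m [Yy Xx]; have {}fz := fz (conj Yy Xx).
  rewrite gee0_abs// /pos /D; move: Yy Xx fz => /= Yy Xx fz.
  have [_ Cy] := C_hypercube y x Yy Xx.
  have NmN : (N <= m + N)%N by rewrite leq_addl.
  have MmN : (M3 <= m + N)%N by exact: leq_trans NmN.
  apply: (log_ratio_domination (h := h (m + N)%N) (C0 := C0 (m + N)%N y x)
    (C1 := C1 (m + N)%N y x) F_density) => //.
  - by move=> j; exact: cond_prob_gt0.
  - exact: Nh.
  - exact: Ns.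
  - exact: C0_hypercube.
  - exact: C1_hypercube.
have [Z [mZ Z0 Zin]] := not_interior_null delta_gt0 A_partition
  fine_partition.
have aeZ : {ae F, forall z : 'rV[R]_d * 'rV[R]_dx, ~ Z z.1}.
  exists (Z `*` setT); split.
  - exact: measurableX.
  - exact: (null_cylinder F_density).
  - by move=> [y x]/= /contrapT.
have ptw : {ae F, forall z, (Y `*` X) z -> pos (m + N)%N z @[m --> \oo] --> 0%E}.
  apply: filterS3 fpos aeZ f_continuous => -[y x] fz nZ fc [/= Yy Xx].
  have {}fz := fz (conj Yy Xx); have {}fc := fc (conj Yy Xx).
  rewrite (cvg_shiftn N (fun m => pos m (y, x))).
  apply: cvg_EFin; first exact: nearW.
  apply/cvgrPdist_le => e e0.
  have H := model0_lower_limit F_density h_gt0 delta_gt0 sigma_gt0 sigma0_gt0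
    A_partition (fine_partition y Yy) delta_cvg0 sigma_delta_cvg0 hs Xx
    (fun m j => cond_prob_gt0 m j x Xx) fz (Zin y Yy nZ) fc e0.
  near=> m.
  have pm : f y x * expR (- e) <= p0 m y x by near: m; exact: H.
  rewrite /= sub0r normrN ger0_norm ?le_max ?lexx ?orbT// ge_max (ltW e0) andbT.
  move: pm; rewrite -ler_ln ?posrE ?mulr_gt0 ?expR_gt0 ?p0_gt0//.
  by rewrite lnM ?posrE ?expR_gt0// expRK; lra.
have [_ _] := dominated_convergence mYX (fun m => mpos (m + N)%N)
  (measurable_cst (0%E : \bar R)) ptw iD dom.
rewrite integral0 => posc.
have {}posc : (\int[F]_(z in Y `*` X) pos m z)%E @[m --> \oo] --> 0%E.
  by rewrite -(cvg_shiftn N).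
have KL0c : KL0 m @[m --> \oo] --> 0%E.
  apply: (squeeze_cvge _ (cvg_cst 0%E) posc).
  apply: nearW => m; apply/andP; split.
    apply: (dKL_ge0 F_density (mp0 m) (p0_gt0 m)).
    move=> x Xx; apply: integral_mixture_le1 => //.
      by move=> j; rewrite ltW// cond_prob_gt0.
    exact: sum1.
  exact: (dKL_le_funepos F_density (mp0 m) (p0_gt0 m)).
have eps2c : (2 * eps m)%:E @[m --> \oo] --> 0%E.
  apply: cvg_EFin; first exact: nearW.
  rewrite -[X in _ --> X](mulr0 2).
  by apply: cvgMr.
apply: (squeeze_cvge (f := fun m => (KL0 m - (2 * eps m)%:E)%E)
  (h := fun m => (KL0 m + (2 * eps m)%:E)%E)).
- by apply: nearW => m; have [-> ->] := sandwich m.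
- rewrite -[X in _ --> X](sube0 0%E); apply: cvgeB => //.
- rewrite -[X in _ --> X](adde0 0%E); apply: cvgeD => //.
Unshelve. all: by end_near. Qed.
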